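(* Let $K$ be a field, $n\ge 1$ an integer and $\delta\subseteq\{2,\ldots,n\}$. Let $S_\delta$ be the polynomial ring over $K$ in the variables $x_1,\ldots,x_n$ and $y_j$ ($1\le j\le n$, $j\notin\delta$), and let $I_n(\delta)\subset S_\delta$ be the ideal generated by all $2$-minors of the $2\times n$ matrix $$X_n(\delta)=\begin{bmatrix} x_1 & x_2 & \cdots & x_n\\ \xi_1 & \xi_2 & \cdots & \xi_n\end{bmatrix},\qquad \xi_i=\begin{cases} y_i, & i\notin\delta,\\ x_{i-1}, & i\in\delta.\end{cases}$$ Then: (i) the ideal $I_n(\delta)\subset S_\delta$ is prime; (ii) the quotient ring $S_\delta/I_n(\delta)$ is Cohen--Macaulay; (iii) $I_n(\delta)$ has a linear resolution.
   Context: The polynomial ring $S_\delta$ has the standard grading (all variables have degree $1$). The $2$-minors are the polynomials $x_i\xi_j-x_j\xi_i$, $1\le i<j\le n$. A graded ideal $I$ generated in degree $2$ has a linear resolution if its minimal graded free resolution is $2$-linear, i.e. $\operatorname{Tor}_i(I,K)_j=0$ for all $i\ge 0$ and all $j\ne i+2$ (vacuously satisfied by the zero ideal). *)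

(* Defs.v *)
From HB Require Import structures.
From mathcomp Require Import all_boot all_order all_algebra.
From mathcomp Require Import boolp.
From mathcomp Require Import mpoly.

Set Implicit Arguments.
Unset Strict Implicit.
Unset Printing Implicit Defensive.

Import GRing.Theory.
Local Open Scope ring_scope.

(* Subsets of a ring are boolean predicates throughout; as equality and
   membership are decided classically (asbool), every subset is of this form.
   MathComp's idealr_closed includes properness (1 \notin S). *)
Section Ideals.
Variable R : comNzRingType.
Implicit Types (s : seq R) (M J : {pred R}).

Definition ideal_gen s : {pred R} :=
  fun p => `[< exists c : 'I_(size s) -> R, p = \sum_i c i * s`_i >].

Definition prime_ideal J := idealr_closed J /\ prime_idealr_closed J.

Definition maximal_ideal M :=
  idealr_closed M /\
  forall J, idealr_closed J -> {subset M <= J} -> {subset J <= M}.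

(* Only proper ideals are quantified over: the unit ideal is generated by 1. *)
Definition noetherian :=
  forall J, idealr_closed J -> exists s, J =i ideal_gen s.

Definition prime_chain (P : nat -> {pred R}) (d : nat) :=
  (forall i, (i <= d)%N -> prime_ideal (P i)) /\
  (forall i, (i < d)%N ->
     {subset P i <= P i.+1} /\ ~ {subset P i.+1 <= P i}).

Definition krull_dim (d : nat) :=
  (exists P, prime_chain P d) /\
  (forall P e, prime_chain P e -> (e <= d)%N).

Definition regular_sequence s :=
  1 \notin ideal_gen s /\
  forall i a, (i < size s)%N ->
    a * s`_i \in ideal_gen (take i s) -> a \in ideal_gen (take i s).

Definition depth M (d : nat) :=
  (exists s, [/\ size s = d, {subset s <= M} & regular_sequence s]) /\
  (forall s, {subset s <= M} -> regular_sequence s -> (size s <= d)%N).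

Definition cohen_macaulay_local :=
  noetherian /\
  exists M, [/\ maximal_ideal M,
                forall M', maximal_ideal M' -> M' =i M
              & exists d, krull_dim d /\ depth M d].

End Ideals.

(* f exhibits A as the localization of R at the complement of P. *)
Definition is_localization (R : comNzRingType) (P : {pred R})
    (A : comNzRingType) (f : {rmorphism R -> A}) :=
  [/\ forall s, s \notin P -> exists t, f s * t = 1,
      forall a, exists r s, s \notin P /\ a * f s = f r
    & forall r, f r = 0 -> exists s, s \notin P /\ s * r = 0].

(* The localization is determined by is_localization up to unique isomorphism,
   so quantifying over all of its models is harmless. *)
Definition cohen_macaulay (R : comNzRingType) :=
  noetherian R /\
  forall M : {pred R}, maximal_ideal M ->
  forall (A : comNzRingType) (f : {rmorphism R -> A}),
    is_localization M f -> cohen_macaulay_local A.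

Section Resolutions.
Variables (K : fieldType) (N : nat).
Local Notation S := {mpoly K[N]}.

(* F_i = 'rV[S]_(res_rank i), its k-th basis vector being in degree
   res_deg i k, i.e. F_i = \bigoplus_k S(- res_deg i k).  The maps
   F_0 -> S and F_(i+1) -> F_i are right multiplications v |-> v *m _. *)
Record free_complex := FreeComplex {
  res_rank : nat -> nat;
  res_deg : forall i, 'I_(res_rank i) -> nat;
  res_aug : 'cV[S]_(res_rank 0);
  res_diff : forall i, 'M[S]_(res_rank i.+1, res_rank i)
}.

Definition homog_of_deg_diff (a b : nat) (p : S) : bool :=
  if (b <= a)%N then p \is (a - b).-homog else p == 0.

Definition graded_complex (F : free_complex) :=
  (forall k, res_aug F k 0 \is (res_deg k).-homog) /\
  (forall i k l, homog_of_deg_diff (res_deg k) (res_deg l) (res_diff F i k l)).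

Definition resolves (I : {pred S}) (F : free_complex) :=
  [/\ forall p, p \in I <-> exists v : 'rV_(res_rank F 0), p = (v *m res_aug F) 0 0,
      forall v : 'rV_(res_rank F 0),
        v *m res_aug F = 0 <-> exists w, v = w *m res_diff F 0
    & forall i (v : 'rV_(res_rank F i.+1)),
        v *m res_diff F i = 0 <-> exists w, v = w *m res_diff F i.+1].

(* The image of F_(i+1) lies in (X_0, ..., X_(N-1)) F_i. *)
Definition minimal_complex (F : free_complex) :=
  forall i k l, (res_diff F i k l)@_0%MM = 0.

Definition minimal_graded_free_resolution (I : {pred S}) (F : free_complex) :=
  [/\ graded_complex F, resolves I F & minimal_complex F].

(* As F is minimal, Tor_i(I, K)_j has dimension #{k | res_deg i k = j}. *)
Definition linear_resolution (q : nat) (I : {pred S}) :=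
  exists F, minimal_graded_free_resolution I F /\
    forall i (k : 'I_(res_rank F i)), res_deg k = (i + q)%N.

End Resolutions.

(* Indices are shifted down by one: columns are numbered 0, ..., n-1, and the
   requirement delta \subseteq {2, ..., n} becomes 0 \notin delta. *)
Section TwoMinors.
Variables (K : fieldType) (n : nat) (delta : {set 'I_n}).

Definition vars : finType := ('I_n + {j : 'I_n | j \notin delta})%type.

Local Notation S := {mpoly K[#|vars|]}.

Definition xvar (i : 'I_n) : S := 'X_(enum_rank (inl i : vars)).
Definition yvar (j : {j : 'I_n | j \notin delta}) : S :=
  'X_(enum_rank (inr j : vars)).

(* insub i is Some j, with val j = i, exactly when i \notin delta; for i > 0
   the value of ord_pred i is i - 1. *)
Definition xi (i : 'I_n) : S :=
  if insub i is Some j then yvar j else xvar (ord_pred i).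

Definition X_mx : 'M[S]_(2, n) :=
  \matrix_(r, i) (if r == 0 then xvar i else xi i).

Definition minor2 (i j : 'I_n) : S :=
  X_mx 0 i * X_mx 1 j - X_mx 0 j * X_mx 1 i.

Definition minors2 : seq S :=
  [seq minor2 ij.1 ij.2 | ij in [pred ij : 'I_n * 'I_n | (ij.1 < ij.2)%N]].

Definition minor_ideal : {pred S} := ideal_gen minors2.

Lemma X_mx_coef0 r i : (X_mx r i)@_0 = 0.
Proof.
rewrite mxE /xi; case: (r == 0); last case: insubP => [j _ _|_];
  by rewrite mcoeffX mnm1_eq0.
Qed.

Lemma minor_ideal_closed : idealr_closed minor_ideal.
Proof.
split.
- by apply/asboolP; exists (fun=> 0); rewrite big1 // => i _; rewrite mul0r.
- apply/asboolP => -[c /(congr1 (mcoeff 0))].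
  rewrite mcoeff1 eqxx raddf_sum big1 => [/eqP|/= i _].
    by rewrite oner_eq0.
  rewrite rmorphM /=; have /mapP[[j k] _ ->] := mem_nth 0 (ltn_ord i).
  by rewrite /minor2 mcoeffB !rmorphM /= !X_mx_coef0 !mul0r subr0 mulr0.
- move=> a u v /asboolP[c ->] /asboolP[d ->].
  apply/asboolP; exists (fun i => a * c i + d i).
  by rewrite mulr_sumr -big_split; apply: eq_bigr => i _; rewrite mulrDl mulrA.
Qed.

HB.instance Definition _ :=
  isIdealr.Build S (minor_ideal : S -> bool) minor_ideal_closed.

End TwoMinors.

Arguments minor_ideal K [n] delta _ : rename.

(* Main.v *)
(* Idea.  Let sigma be the involution of S that fixes the x_i and y_1 and sends
   y_j to x_(j-1) - y_j for j > 1.  In the coordinates it provides, every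
   product x_i x_k with i <= k < n is congruent modulo the minors to
   x_(i-1) x_(k+1) plus terms x_a y_b, so S/I is spanned over
   P = K[y_j, x_n] by 1, x_1, ..., x_(n-1).  The map x_i |-> u_i t, xi_i |-> u_i
   kills I, and leading terms in t show that these n elements are linearly
   independent over P.  Hence I is the kernel of a map to the domain S[t], and
   S = I (+) Std, where Std is spanned by the monomials of degree at most 1 in
   z = (x_1, ..., x_(n-1)).
   Linear resolution: a syzygy module that has a complement spanned by
   monomials z^a e_g with all z-variables of index >= mx(g) is generated by
   elements z_c e_g - (standard tail) with c < mx(g), and their syzygies again
   have such a complement, with mx = c; this iterates.
   Cohen-Macaulay: chains of primes are bounded because |P-variables| + 1
   elements of S/I are algebraically dependent; conversely, for a maximal ideal M
   and each P-variable v, Zariski's lemma gives a monic g_v with g_v(v) in M, and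
   freeness over P makes the g_v(v) a regular sequence. *)
From HB Require Import structures.
Require Import Defs.
From mathcomp Require Import all_boot all_order all_algebra.
From mathcomp Require Import boolp mpoly ring zify.

Set Implicit Arguments.
Unset Strict Implicit.
Unset Printing Implicit Defensive.
Import Order.TTheory GRing.Theory.
Local Open Scope ring_scope.

(** * Ideals, prime chains and localization *)

(** The obstacle is that [xi] has two shapes. The differences theta_j = x_(j-1) - xi_j unify them:
    theta_j is 0 for j in delta, and for every other j > 1 it is a free coordinate, the image of y_j
    under sigma. If all theta_j were 0, the second row would be y_1, x_1, ..., x_(n-1), the case of
    the rational normal curve of degree n, whose coordinate ring is free of rank n over K[y_1, x_n].
    The theta_j perturb each rewriting rule only by terms of degree at most 1 in z, so the same
    basis survives. The recursion u_i = t u_(i-1) - theta_i is forced by x_(i-1) = t xi_(i-1) and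
    xi_i = x_(i-1) - theta_i. As K is arbitrary, a maximal ideal need not be a K-rational point, so
    a polynomial g_v takes the place of v - a. The dimension of a localization is squeezed rather
    than computed: a regular sequence always yields a chain of primes of the same length, so a
    regular sequence that reaches the bound on chains settles both depth and dimension. *)

Section IdealGen.
Variable R : comNzRingType.
Implicit Types (s : seq R) (J Q : {pred R}) (a u v x : R).

(* Unlike idealr_closed, this allows the unit ideal. *)
Definition lin_closed J := 0 \in J /\ forall a, {in J &, forall u v, a * u + v \in J}.

Lemma idealr_lin J : idealr_closed J -> lin_closed J.
Proof. by case. Qed.

Lemma linD J : lin_closed J -> {in J &, forall u v, u + v \in J}.
Proof. by case=> _ H u v Ju Jv; rewrite -[u]mul1r; apply: H. Qed.

Lemma linM J : lin_closed J -> forall a, {in J, forall u, a * u \in J}.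
Proof. by case=> J0 H a u Ju; rewrite -[_ * _]addr0; apply: H. Qed.

Lemma linN J : lin_closed J -> {in J, forall u, - u \in J}.
Proof. by move=> HJ u Ju; rewrite -mulN1r; apply: (linM HJ). Qed.

Lemma linB J : lin_closed J -> {in J &, forall u v, u - v \in J}.
Proof. by move=> HJ u v Ju Jv; apply: linD => //; apply: linN. Qed.

Lemma lin_sum J (I : Type) (r : seq I) (P : pred I) (F : I -> R) :
  lin_closed J -> (forall i, P i -> F i \in J) -> \sum_(i <- r | P i) F i \in J.
Proof.
by move=> HJ FJ; apply: (big_ind (fun x => x \in J)) => //;
  [case: HJ | move=> x y; apply: linD].
Qed.

Lemma ideal_gen_lin s : lin_closed (ideal_gen s).
Proof.
split.
  by apply/asboolP; exists (fun=> 0); rewrite big1 // => i _; rewrite mul0r.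
move=> a u v /asboolP[c ->] /asboolP[d ->]; apply/asboolP.
exists (fun i => a * c i + d i).
by rewrite mulr_sumr -big_split; apply: eq_bigr => i _; rewrite mulrDl mulrA.
Qed.

Lemma ideal_gen_nth s i : (i < size s)%N -> s`_i \in ideal_gen s.
Proof.
move=> lt_i; apply/asboolP; exists (fun j => (nat_of_ord j == i)%:R).
rewrite (bigD1 (Ordinal lt_i)) //= eqxx mul1r big1 ?addr0 // => j neq_j.
by rewrite (negPf (_ : nat_of_ord j != i)) ?mul0r.
Qed.

Lemma ideal_gen_mem s : {subset s <= ideal_gen s}.
Proof. by move=> x /(nthP 0)[i lt_i <-]; apply: ideal_gen_nth. Qed.

Lemma ideal_gen_min s J : lin_closed J -> {subset s <= J} ->
  {subset ideal_gen s <= J}.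
Proof.
move=> HJ sJ _ /asboolP[c ->]; apply: lin_sum => // i _.
by apply: linM => //; apply/sJ/mem_nth.
Qed.

Lemma prime_expr Q x k : prime_ideal Q -> x ^+ k \in Q -> x \in Q.
Proof.
case=> -[_ Q1 _] Qp; elim: k => [|k IHk]; first by rewrite expr0 (negPf Q1).
by rewrite exprS => /Qp /orP[].
Qed.

Definition adjoin J u : {pred R} := fun x => `[< exists a, x - a * u \in J >].

Lemma adjoinP J u x : reflect (exists a, x - a * u \in J) (x \in adjoin J u).
Proof. exact: asboolP. Qed.

Lemma adjoin_lin J u : lin_closed J -> lin_closed (adjoin J u).
Proof.
move=> HJ; split; first by apply/adjoinP; exists 0; rewrite mul0r subr0; case: HJ.
move=> a x y /adjoinP[b Jb] /adjoinP[c Jc]; apply/adjoinP; exists (a * b + c).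
rewrite (_ : _ - _ = a * (x - b * u) + (y - c * u)); first exact: HJ.2.
by ring.
Qed.

Lemma adjoin_sub J u : {subset J <= adjoin J u}.
Proof. by move=> x Jx; apply/adjoinP; exists 0; rewrite mul0r subr0. Qed.

Lemma adjoin_self J u : lin_closed J -> u \in adjoin J u.
Proof. by move=> HJ; apply/adjoinP; exists 1; rewrite mul1r subrr; case: HJ. Qed.

Lemma maximal_prime J : maximal_ideal J -> prime_ideal J.
Proof.
case=> J_id J_max; split=> // u v Juv; have HJ := idealr_lin J_id.
apply/orP; have [Ju|Ju] := boolP (u \in J); [by left|right].
have /adjoinP[a Ja] : 1 \in adjoin J u.
  apply: contraT => adj1; case/negP: Ju.
  apply: (J_max (adjoin J u)) (adjoin_self _ HJ); last exact: adjoin_sub.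
  by have [H0 H1] := adjoin_lin u HJ; split.
rewrite (_ : v = v * (1 - a * u) + a * (u * v)); last by ring.
by apply: linD => //; apply: linM.
Qed.

End IdealGen.

(** * Noetherian rings: regular sequences and chains of primes *)

Section Noetherian.
Variable R : comNzRingType.
Hypothesis noethR : noetherian R.
Implicit Types (s : seq R) (J Q : {pred R}) (a u v x : R).

(** An endless strictly increasing sequence of ideals satisfying [P] would have a union generated by
    finitely many elements, all present at one stage. The union is proper because its members are,
    as [noetherian] demands. *)
Lemma noetherian_maximal (P : {pred R} -> Prop) J0 :
  (forall J, P J -> idealr_closed J) -> P J0 ->
  exists2 J, P J & forall J', P J' -> {subset J <= J'} -> {subset J' <= J}.
Proof.
move=> P_id PJ0; apply: contrapT => noJ.
have next (J : {J | P J}) : exists J' : {J | P J},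
    {subset sval J <= sval J'} /\ ~ {subset sval J' <= sval J}.
  apply: contrapT => noJ'; apply: noJ; exists (sval J); first exact: svalP J.
  move=> J' PJ' sJJ'; apply: contrapT => nsJ'J.
  by apply: noJ'; exists (exist _ J' PJ').
have [f fP] := choice next.
pose I k := sval (iter k f (exist _ J0 PJ0)).
have I_id k : idealr_closed (I k) by apply: P_id; apply: svalP.
have I_mono k l : (k <= l)%N -> {subset I k <= I l}.
  move=> le_kl; rewrite -(subnK le_kl); elim: (l - k)%N => [//|j IHj] x /IHj.
  exact: (fP _).1.
pose U : {pred R} := fun x => `[< exists k, x \in I k >].
have [|s Us] := noethR (J := U).
  split; first by apply/asboolP; exists 0%N; case: (I_id 0%N).
    by apply/asboolP=> -[k]; case: (I_id k) => _ /negP.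
  move=> a u v /asboolP[k Iu] /asboolP[l Iv]; apply/asboolP; exists (maxn k l).
  case: (I_id (maxn k l)) => _ _; apply.
    by apply: I_mono Iu; apply: leq_maxl.
  by apply: I_mono Iv; apply: leq_maxr.
have [k sIk] : exists k, {subset s <= I k}.
  have : {subset s <= U} by move=> x sx; rewrite Us; apply: ideal_gen_mem.
  elim: s {Us} => [|x s IHs] sU; first by exists 0%N.
  have [|k sIk] := IHs; first by move=> y sy; apply: sU; rewrite inE sy orbT.
  have /asboolP[l Ix] := sU x (mem_head _ _).
  exists (maxn k l) => y; rewrite inE => /orP[/eqP ->|/sIk Iy].
    by apply: I_mono Ix; apply: leq_maxr.
  by apply: I_mono Iy; apply: leq_maxl.
have [_ []] := fP (iter k f (exist _ J0 PJ0)); move=> x Ix.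
apply: (ideal_gen_min (idealr_lin (I_id k)) sIk).
by rewrite -Us; apply/asboolP; exists k.+1.
Qed.

(* An ideal that contains J and is maximal among those disjoint from the
   multiplicative set { s x^k | s \notin Q } is prime. *)
Lemma prime_below J Q x : prime_ideal Q -> idealr_closed J ->
    {subset J <= Q} -> (forall a, a * x \in J -> a \in J) ->
  exists Q', [/\ prime_ideal Q', {subset J <= Q'}, {subset Q' <= Q} & x \notin Q'].
Proof.
move=> [Q_id Q_prime] J_id sJQ x_reg.
have Q1 : 1 \notin Q by case: Q_id.
pose P J' := [/\ idealr_closed J', {subset J <= J'}
  & forall y k, y \notin Q -> y * x ^+ k \notin J'].
have [||J' [J'_id sJJ' J'_disj] J'_max] := @noetherian_maximal P J.
- by move=> J' [].
- split=> // y k; apply: contra.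
  elim: k => [|k IHk]; first by rewrite expr0 mulr1; apply: sJQ.
  by rewrite exprSr mulrA => /x_reg.
have HJ' := idealr_lin J'_id.
exists J'; split=> //; first split=> // u v.
- move=> J'uv; apply: contraT; rewrite negb_or => /andP[J'u J'v].
  have meet w : w \notin J' -> exists y k, y \notin Q /\ y * x ^+ k \in adjoin J' w.
    move=> J'w; apply: contrapT => disj; case/negP: J'w.
    have disj' y k : y \notin Q -> y * x ^+ k \notin adjoin J' w.
      by move=> Qs; apply/negP=> H; apply: disj; exists y, k.
    apply: (J'_max (adjoin J' w)) (adjoin_self _ HJ'); last exact: adjoin_sub.
    have [H0 H1] := adjoin_lin w HJ'; split=> //.
      by split=> //; have := disj' 1 0%N Q1; rewrite mulr1.
    by move=> z /sJJ'; apply: adjoin_sub.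
  have [y [k [Qy /adjoinP[a Ja]]]] := meet _ J'u.
  have [t [l [Qt /adjoinP[b Jb]]]] := meet _ J'v.
  have /negP[] : (y * t) * x ^+ (k + l) \notin J'.
    by apply: J'_disj; apply/negP=> /Q_prime; rewrite (negPf Qy) (negPf Qt).
  rewrite (_ : _ * _ = (t * x ^+ l) * (y * x ^+ k - a * u)
      + (a * u) * (t * x ^+ l - b * v) + (a * b) * (u * v)).
    by apply: (linD HJ'); [apply: (linD HJ')|]; apply: (linM HJ').
  by rewrite exprD; ring.
- move=> y J'y; apply: contraT => Qy.
  by have := J'_disj y 0%N Qy; rewrite mulr1 J'y.
- by have := J'_disj 1 1%N Q1; rewrite mul1r.
Qed.

(** The cancellation half of [regular_sequence]; properness of the generated ideal comes from an
    ideal M containing s ([loc_regular]). *)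
Definition weakly_regular s := forall i a, (i < size s)%N ->
  a * s`_i \in ideal_gen (take i s) -> a \in ideal_gen (take i s).

(** This is depth <= dimension. The chain is built downwards from Q: the last element of s is a
    nonzerodivisor modulo the ideal of the earlier ones, so [prime_below] yields a smaller prime
    that keeps those and loses it. *)
Lemma regular_prime_chain s Q : prime_ideal Q -> {subset s <= Q} ->
  weakly_regular s -> exists P : nat -> {pred R}, prime_chain P (size s).
Proof.
move=> + + s_reg; suff H k : (k <= size s)%N -> forall Q, prime_ideal Q ->
    {subset take k s <= Q} -> exists2 P, prime_chain P k & P k = Q.
  move=> Qp sQ; have [|P P_chain _] := H _ (leqnn (size s)) Q Qp.
    by rewrite take_size.
  by exists P.
elim: k => [|k IHk] lt_k {}Q Qp sQ.
  by exists (fun=> Q) => //; split=> // i; rewrite ltn0.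
have sQk : {subset take k s <= Q}.
  by move=> x; rewrite -(take_takel s (leqnSn k)) => /mem_take /sQ.
have sgQ : {subset ideal_gen (take k s) <= Q}.
  by apply: ideal_gen_min => //; apply: idealr_lin; case: Qp.
have k_id : idealr_closed (ideal_gen (take k s)).
  have [H0 H1] := ideal_gen_lin (take k s); split=> //.
  by apply/negP=> /sgQ; case: Qp => -[_ /negP].
have [Q' [Q'p sQ' Q'Q Q'x]] := prime_below Qp k_id sgQ (fun a => s_reg k a lt_k).
have [|P [P_prime P_chain] PQ'] := IHk (ltnW lt_k) Q' Q'p.
  by move=> x /ideal_gen_mem /sQ'.
exists (fun i => if (i <= k)%N then P i else Q); last by rewrite ltnn.
split=> i; first by case: ifP => // le_ik _; apply: P_prime.
rewrite ltnS => le_ik; rewrite le_ik; case: ltnP => [lt_ik|le_ki].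
  exact: P_chain.
have -> : i = k by apply/eqP; rewrite eqn_leq le_ik le_ki.
rewrite PQ'; split=> // QQ'; case/negP: Q'x; apply/QQ'/sQ.
by rewrite (take_nth 0) // mem_rcons mem_head.
Qed.

(** Regular sequences turn into chains ([regular_prime_chain]), so one sequence as long as the bound
    on chains attains both the dimension and the depth. *)
Lemma cohen_macaulay_local_intro (M : {pred R}) s :
    maximal_ideal M -> (forall M', maximal_ideal M' -> M' =i M) ->
    {subset s <= M} -> regular_sequence s ->
    (forall (P : nat -> {pred R}) e, prime_chain P e -> (e <= size s)%N) ->
  cohen_macaulay_local R.
Proof.
move=> M_max M_uniq sM s_reg le_dim; split=> //; exists M; split=> //.
have M_prime := maximal_prime M_max.
exists (size s); split; split.
- by case: s_reg => _; apply: regular_prime_chain M_prime sM.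
- by [].
- by exists s.
- move=> s' s'M [_ /(regular_prime_chain M_prime s'M)[P]].
  exact: le_dim.
Qed.

End Noetherian.

(** * Algebraic independence along a chain of primes *)

Section ChainIndependence.
Variables (K : fieldType) (k : nat).

(** Exponent vectors with entries below k, as nested pairs, so that an induction on the length of
    the chain can split off x_0. *)
Fixpoint exponents j : finType :=
  if j is j'.+1 then ('I_k * exponents j')%type else unit.

Fixpoint monomial (R : comNzRingType) (x : nat -> R) j : exponents j -> R :=
  if j is j'.+1 then fun p : exponents j'.+1 =>
    x 0%N ^+ p.1 * monomial (fun i => x i.+1) p.2
  else fun=> 1.

Lemma monomial_rmorph (R A : comNzRingType) (f : {rmorphism R -> A}) x j
  (p : exponents j) : f (monomial x p) = monomial (f \o x) p.
Proof.
elim: j x p => [|j IHj] x p /=; first exact: rmorph1.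
by rewrite rmorphM rmorphXn IHj.
Qed.

Lemma card_exponents j : #|exponents j| = (k ^ j)%N.
Proof. by elim: j => [|j IHj] /=; rewrite ?card_unit // card_prod IHj card_ord expnS. Qed.

(* The lexicographically smallest term of a relation modulo P 0 would have a
   unit coefficient in P j. *)
Lemma chain_independent (A : comNzRingType) (iota : {rmorphism K -> A})
    (P : nat -> {pred A}) (x : nat -> A) j (c : exponents j -> K) :
    (forall i, (i <= j)%N -> prime_ideal (P i)) ->
    (forall i, (i < j)%N -> [/\ {subset P i <= P i.+1}, x i \in P i.+1 & x i \notin P i]) ->
    \sum_p iota (c p) * monomial x p \in P 0%N ->
  forall p, c p = 0.
Proof.
elim: j P x c => [|j IHj] P x c P_prime P_chain.
  rewrite (big_pred1 tt) => [|[]//]; rewrite /= mulr1 => Pc [].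
  apply: contrapT => /eqP c_neq0; have [[P0 P1 Plin] _] := P_prime 0%N isT.
  case/negP: P1; rewrite -(rmorph1 iota) -(mulVf c_neq0) rmorphM.
  by rewrite -[_ * _]addr0; apply: Plin.
pose y i := x i.+1; pose inner e := \sum_p iota (c (e, p)) * monomial y p.
have -> : \sum_p iota (c p) * monomial x p = \sum_(e < k) x 0%N ^+ e * inner e.
  transitivity (\sum_(e < k) \sum_p x 0%N ^+ e * (iota (c (e, p)) * monomial y p)).
    by rewrite pair_bigA /=; apply: eq_bigr => -[e p] _ /=; rewrite mulrCA.
  by apply: eq_bigr => e _; rewrite mulr_sumr.
move=> sumP.
suff H n : forall e : 'I_k, (e < n)%N -> forall p, c (e, p) = 0.
  by case=> e p; apply: H (ltnSn e) _.
elim: n => [//|n IHn] e; rewrite ltnS leq_eqVlt => /orP[/eqP def_n|/IHn//].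
have [sP01 Px0 nPx0] := P_chain 0%N isT.
have [HP0 P0_prime] := P_prime 0%N isT; have HP0l := idealr_lin HP0.
have HP1l : lin_closed (P 1%N) by apply: idealr_lin; case: (P_prime 1%N isT).
apply: (IHj (fun i => P i.+1) y) => [i le_ij|i lt_ij|].
- exact: P_prime.
- exact: (P_chain i.+1).
rewrite -/(inner e).
pose rest := \sum_(i < k | (e < i)%N) x 0%N ^+ (i - e).-1 * inner i.
have def_sum : \sum_(i < k) x 0%N ^+ i * inner i =
    x 0%N ^+ e * (inner e + x 0%N * rest).
  rewrite (bigID (fun i : 'I_k => (i < e)%N)) /= big1 ?add0r => [|i lt_ie]; last first.
    rewrite /inner big1 ?mulr0 // => p _.
    by rewrite IHn ?rmorph0 ?mul0r // -def_n.
  rewrite (bigD1 e) ?ltnn //= mulrDr; congr (_ + _).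
  rewrite mulrA -exprSr mulr_sumr; apply: eq_big => [i|i lt_ei].
    by rewrite -leqNgt [RHS]ltn_neqAle eq_sym andbC.
  rewrite mulrA -exprD; congr (_ ^+ _ * _).
  move: lt_ei; rewrite -leqNgt => /andP[le_ei neq_ie].
  by rewrite addSnnS prednK ?subnKC // subn_gt0 ltn_neqAle eq_sym neq_ie.
(* x_0 lies outside P 0, so its power cancels modulo P 0; modulo P 1, where x_0 vanishes, only
   [inner e] remains, a relation for the rest of the chain. *)
move: sumP; rewrite def_sum => /P0_prime /orP[P0x|/sP01 P1sum].
  by case/negP: nPx0; apply: prime_expr P0x; split.
rewrite -[inner e](addrK (x 0%N * rest)); apply: (linB HP1l) => //.
by rewrite mulrC; apply: (linM HP1l).
Qed.

End ChainIndependence.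

(** * Localization at a maximal ideal *)

Section Localization.
Variables (R : comNzRingType) (M : {pred R}) (A : comNzRingType).
Variable f : {rmorphism R -> A}.
Hypothesis M_max : maximal_ideal M.
Hypothesis f_loc : is_localization M f.

Let M_prime : prime_ideal M := maximal_prime M_max.
Let M_lin : lin_closed M. Proof. by apply: idealr_lin; case: M_max. Qed.

Lemma loc_unit s : s \notin M -> exists t, f s * t = 1.
Proof. by case: f_loc => + _ _; apply. Qed.

Lemma loc_frac a : exists r s, s \notin M /\ a * f s = f r.
Proof. by case: f_loc => _ + _; apply. Qed.

Lemma loc_eq r r' : f r = f r' -> exists s, s \notin M /\ s * r = s * r'.
Proof.
move=> eq_f; case: f_loc => _ _ /(_ (r - r')) []; first by rewrite rmorphB eq_f subrr.
by move=> s [Ms /eqP]; rewrite mulrBr subr_eq0 => /eqP; exists s.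
Qed.

Lemma notin_maxM s t : s \notin M -> t \notin M -> s * t \notin M.
Proof.
move=> Ms Mt; apply/negP=> /(M_prime.2); by rewrite (negPf Ms) (negPf Mt).
Qed.

Lemma notin_max1 : 1 \notin M. Proof. by case: M_max => -[]. Qed.

Lemma loc_mem (J : {pred A}) s a :
  lin_closed J -> s \notin M -> (a * f s \in J) = (a \in J).
Proof.
move=> HJ Ms; apply/idP/idP=> [Ja|Ja]; last by rewrite mulrC; apply: (linM HJ).
have [t st1] := loc_unit Ms; rewrite -[a]mulr1 -st1 mulrA mulrC.
exact: (linM HJ).
Qed.

Definition contraction (J : {pred A}) : {pred R} := fun r => f r \in J.

Lemma contraction_closed J : idealr_closed J -> idealr_closed (contraction J).
Proof.
case=> J0 J1 Jlin; split; rewrite ?/(contraction _) ?unfold_in.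
- by rewrite rmorph0.
- by rewrite rmorph1.
- by move=> a u v Ju Jv; rewrite unfold_in rmorphD rmorphM; apply: Jlin.
Qed.

Lemma loc_noetherian : noetherian R -> noetherian A.
Proof.
move=> noethR J J_id; have [s Js] := noethR _ (contraction_closed J_id).
have HJ := idealr_lin J_id; exists (map f s) => a; apply/idP/idP; last first.
  apply: ideal_gen_min => // _ /mapP[r sr ->].
  by have := ideal_gen_mem sr; rewrite -Js.
have [r [t [Mt def_a]]] := loc_frac a.
rewrite -(loc_mem a HJ Mt) -(loc_mem a (ideal_gen_lin _) Mt) def_a => Jr.
have : r \in ideal_gen s by rewrite -Js.
case/asboolP=> c ->; rewrite rmorph_sum; apply: (lin_sum _ (ideal_gen_lin _)) => i _.
rewrite rmorphM; apply: (linM (ideal_gen_lin _)); apply: ideal_gen_mem.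
by apply/map_f/mem_nth.
Qed.

Definition loc_max : {pred A} :=
  fun a => `[< exists r s, [/\ r \in M, s \notin M & a * f s = f r] >].

Lemma notin_loc_max a : a \notin loc_max -> exists b, b * a = 1.
Proof.
move=> /asboolP Ma; have [r [s [Ms def_a]]] := loc_frac a.
have [Mr|Mr] := boolP (r \in M); first by case: Ma; exists r, s.
have [t rt1] := loc_unit Mr; exists (t * f s).
by rewrite -mulrA [f s * a]mulrC def_a mulrC.
Qed.

Lemma loc_max_closed : idealr_closed loc_max.
Proof.
split.
- apply/asboolP; exists 0, 1; split; [by case: M_lin | exact: notin_max1|].
  by rewrite mul0r rmorph0.
- apply/asboolP=> -[r [s [Mr Ms]]]; rewrite mul1r => /loc_eq[t [Mt eq_ts]].
  by have := notin_maxM Mt Ms; rewrite eq_ts (linM M_lin).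
- move=> a u v /asboolP[r [s [Mr Ms def_u]]] /asboolP[r' [s' [Mr' Ms' def_v]]].
  have [b [t [Mt def_a]]] := loc_frac a; apply/asboolP.
  exists ((b * s') * r + (t * s) * r'), (t * s * s'); split.
  + by apply: (linD M_lin); apply: (linM M_lin).
  + by apply: notin_maxM => //; apply: notin_maxM.
  + rewrite !rmorphD !rmorphM -def_a -def_u -def_v; ring.
Qed.

Lemma proper_sub_loc_max J : idealr_closed J -> {subset J <= loc_max}.
Proof.
move=> J_id a Ja; apply: contraT => /notin_loc_max[b ba1].
by case: J_id => J0 /negP J1 Jlin; case: J1; rewrite -ba1 -[_ * _]addr0; apply: Jlin.
Qed.

Lemma loc_max_maximal : maximal_ideal loc_max.
Proof. by split=> [|J J_id _]; [exact: loc_max_closed | exact: proper_sub_loc_max]. Qed.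

Lemma loc_max_unique M' : maximal_ideal M' -> M' =i loc_max.
Proof.
case=> M'_id M'_max a; apply/idP/idP; first exact: proper_sub_loc_max.
by apply: M'_max loc_max_closed _ _; apply: proper_sub_loc_max.
Qed.

Lemma ideal_gen_map s r : r \in ideal_gen s -> f r \in ideal_gen (map f s).
Proof.
case/asboolP=> c ->; rewrite rmorph_sum; apply: (lin_sum _ (ideal_gen_lin _)) => i _.
rewrite rmorphM; apply: (linM (ideal_gen_lin _)); apply: ideal_gen_mem.
by apply/map_f/mem_nth.
Qed.

Lemma ideal_gen_map_frac s a : a \in ideal_gen (map f s) ->
  exists r t, [/\ r \in ideal_gen s, t \notin M & a * f t = f r].
Proof.
pose J : {pred A} := fun a =>
  `[< exists r t, [/\ r \in ideal_gen s, t \notin M & a * f t = f r] >].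
have gen_s := ideal_gen_lin s.
have HJ : lin_closed J.
  split.
    apply/asboolP; exists 0, 1; split; [by case: gen_s | exact: notin_max1|].
    by rewrite mul0r rmorph0.
  move=> c u v /asboolP[r [t [Mr Mt def_u]]] /asboolP[r' [t' [Mr' Mt' def_v]]].
  have [b [w [Mw def_c]]] := loc_frac c; apply/asboolP.
  exists ((b * t') * r + (w * t) * r'), (w * t * t'); split.
  + by apply: (linD gen_s); apply: (linM gen_s).
  + by apply: notin_maxM => //; apply: notin_maxM.
  + rewrite !rmorphD !rmorphM -def_c -def_u -def_v; ring.
move=> /(ideal_gen_min HJ) H; apply/asboolP; apply: H => _ /mapP[r sr ->].
apply/asboolP; exists r, 1; rewrite rmorph1 mulr1; split=> //.
  exact: ideal_gen_mem.
exact: notin_max1.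
Qed.

(** Flatness by hand: denominators are cleared in the relation, regularity of s is applied in R, and
    the accumulated factor outside M is cancelled as a unit of A. *)
Lemma loc_regular s : {subset s <= M} -> weakly_regular s ->
  regular_sequence (map f s).
Proof.
move=> sM s_reg; have HM := loc_max_closed; split.
  apply/negP=> /(ideal_gen_min (idealr_lin HM)) H.
  case: HM => _ /negP HM1 _; apply: HM1; apply: H => _ /mapP[r sr ->]; apply/asboolP.
  by exists r, 1; rewrite rmorph1 mulr1; split=> //; [exact: sM | exact: notin_max1].
move=> i a; rewrite size_map => lt_i; rewrite -map_take (nth_map 0) //.
case/ideal_gen_map_frac=> r [t [gr Mt def_r]].
have [b [v [Mv def_b]]] := loc_frac a.
have [|w [Mw eq_w]] := @loc_eq (b * t * s`_i) (r * v).
  by rewrite !rmorphM -def_b -def_r; ring.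
have : w * b * t \in ideal_gen (take i s).
  apply: s_reg => //; rewrite (_ : _ * _ = w * (b * t * s`_i)); last by ring.
  rewrite eq_w [r * v]mulrC; do 2!apply: (linM (ideal_gen_lin _)); exact: gr.
move/ideal_gen_map; rewrite !rmorphM -def_b.
rewrite (_ : _ * _ = a * f (v * w * t)); last by rewrite !rmorphM; ring.
by rewrite loc_mem //; [exact: ideal_gen_lin | do 2!apply: notin_maxM => //].
Qed.

(** Elements in P (i+1) but not in P i may be taken from R, since denominators are units. In a chain
    longer than d, the first d + 1 of them contradict [chain_independent]. *)
Lemma loc_chain_bound (K : fieldType) (iota : {rmorphism K -> R}) d :
    (forall x : nat -> R, exists k (c : exponents k d.+1 -> K),
      (exists p, c p != 0) /\ \sum_p iota (c p) * monomial x p = 0) ->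
  forall (P : nat -> {pred A}) e, prime_chain P e -> (e <= d)%N.
Proof.
move=> dep P e [P_prime P_chain]; rewrite leqNgt; apply/negP=> lt_de.
have ex_x i : exists r, (i < e)%N -> f r \in P i.+1 /\ f r \notin P i.
  have [lt_ie|_] := ltnP i e; last by exists 0.
  have [_ nsP] := P_chain i lt_ie.
  have [a Pa nPa] : exists2 a, a \in P i.+1 & a \notin P i.
    apply: contrapT => noa; apply: nsP => a Pa.
    by apply: contraT => nPa; case: noa; exists a.
  have [r [s [Ms def_a]]] := loc_frac a; exists r => _.
  have Pl j : (j <= e)%N -> lin_closed (P j).
    by move=> le_je; apply: idealr_lin; case: (P_prime j le_je).
  by rewrite -def_a !loc_mem //; apply: Pl => //; apply: ltnW.
have [x xP] := choice ex_x; have [k [c [[p /eqP c_neq0] sum0]]] := dep x.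
apply: c_neq0; apply: (@chain_independent _ k _ (f \o iota) P (f \o x)) => [i le_i|i lt_i|].
- by apply: P_prime; apply: leq_trans le_i _.
- have lt_ie := leq_trans lt_i lt_de.
  by case: (P_chain i lt_ie) => sP _; case: (xP i lt_ie).
- have := congr1 f sum0; rewrite rmorph0 rmorph_sum /= => sum0'.
  rewrite (eq_bigr (fun p => f (iota (c p) * monomial x p))).
    by rewrite sum0'; case: (P_prime 0%N isT) => -[].
  by move=> q _; rewrite rmorphM monomial_rmorph.
Qed.

End Localization.

Theorem cm_criterion (K : fieldType) (R : comNzRingType)
    (iota : {rmorphism K -> R}) d :
    noetherian R ->
    (forall x : nat -> R, exists k (c : exponents k d.+1 -> K),
      (exists p, c p != 0) /\ \sum_p iota (c p) * monomial x p = 0) ->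
    (forall M : {pred R}, maximal_ideal M ->
      exists s, [/\ size s = d, {subset s <= M} & weakly_regular s]) ->
  cohen_macaulay R.
Proof.
move=> noethR dep reg; split=> // M M_max A f f_loc.
have [s [size_s sM s_reg]] := reg M M_max.
apply: (@cohen_macaulay_local_intro _ (loc_noetherian f_loc noethR)
  (loc_max M f) (map f s)).
- exact: loc_max_maximal.
- by move=> M' M'_max; apply: loc_max_unique.
- move=> _ /mapP[r sr ->]; apply/asboolP; exists r, 1.
  rewrite rmorph1 mulr1; split=> //; first exact: sM.
  exact: notin_max1.
- exact: (loc_regular M_max f_loc sM s_reg).
- by move=> P e; rewrite size_map size_s; apply: (loc_chain_bound f_loc dep).
Qed.

(** * Hilbert basis theorem *)

Section Dickson.

Definition increasing (phi : nat -> nat) := forall i, (phi i < phi i.+1)%N.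

Lemma increasing_lt phi i j : increasing phi -> (i < j)%N -> (phi i < phi j)%N.
Proof.
move=> phi_inc; elim: j => [//|j IHj]; rewrite ltnS leq_eqVlt.
by case/predU1P=> [->//|/IHj lt_ij]; apply: ltn_trans lt_ij _.
Qed.

(** Jump again and again to a place where u attains its minimum over the remaining tail. *)
Lemma nondecreasing_subsequence (u : nat -> nat) :
  exists2 phi, increasing phi & forall i, (u (phi i) <= u (phi i.+1))%N.
Proof.
have min_tail a : exists b, (a <= b)%N /\ forall c, (a <= c)%N -> (u b <= u c)%N.
  have exP : exists n, `[< exists2 b, (a <= b)%N & u b = n >].
    by exists (u a); apply/asboolP; exists a.
  case: (ex_minnP exP) => n /asboolP[b le_ab def_n] n_min.
  exists b; split=> // c le_ac; rewrite def_n; apply: n_min.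
  by apply/asboolP; exists c.
have [B BP] := choice min_tail.
pose phi := fix phi i := if i is i'.+1 then B (phi i').+1 else B 0%N.
exists phi => i /=; first by case: (BP (phi i).+1).
have [le_B _] := BP (phi i).+1.
case: i le_B => [|i] /= le_B; first by case: (BP 0%N) => _; apply.
by case: (BP (phi i).+1) => le1 min1; apply: min1; apply: leq_trans le_B; apply: leqW.
Qed.

(** Subsequences are refined one coordinate at a time; coordinates treated before stay nondecreasing
    along a subsequence. *)
Lemma dickson V (m : nat -> 'X_{1..V}) :
  exists i j, (i < j)%N /\ (m i <= m j)%MM.
Proof.
have [phi phi_inc phi_le] : exists2 phi, increasing phi &
    forall v : 'I_V, (v < V)%N -> forall i, (m (phi i) v <= m (phi i.+1) v)%N.
  suff H n : exists2 phi, increasing phi &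
    forall v : 'I_V, (v < n)%N -> forall i, (m (phi i) v <= m (phi i.+1) v)%N.
    exact: H.
  elim: n => [|n [phi phi_inc phi_le]]; first by exists id => [i|//]; apply: ltnSn.
  have [lt_nV|le_Vn] := ltnP n V; last first.
    by exists phi => // v _; apply: phi_le; apply: leq_trans (ltn_ord v) le_Vn.
  have [psi psi_inc psi_le] := nondecreasing_subsequence (fun i => m (phi i) (Ordinal lt_nV)).
  exists (phi \o psi) => [i|v]; first by apply: increasing_lt (psi_inc i).
  rewrite ltnS leq_eqVlt => /predU1P[eq_vn|lt_vn] i /=.
    by rewrite (_ : v = Ordinal lt_nV); [exact: psi_le | exact: val_inj].
  have lt_psi := psi_inc i; rewrite -(subnK (ltnW lt_psi)).
  elim: (_ - _)%N => [//|k IHk]; apply: leq_trans IHk _.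
  exact: phi_le.
exists (phi 0%N), (phi 1%N); split; first exact: phi_inc.
by apply/mnm_lepP=> v; apply: phi_le.
Qed.

End Dickson.

(** If J were not finitely generated, one could keep choosing an element outside the ideal generated
    so far, with the least possible leading monomial. By [dickson] the leading monomial of some p i
    divides that of a later p j, and cancelling it leaves an element still outside with a smaller
    leading monomial. *)
Theorem hilbert_basis (K : fieldType) V : noetherian {mpoly K[V]}.
Proof.
move=> J J_id.
have HJ := idealr_lin J_id; apply: contrapT => nofg.
have ex_p (s : seq {mpoly K[V]}) : exists p, {subset s <= J} ->
    [/\ p \in J, p \notin ideal_gen s
      & forall q, q \in J -> q \notin ideal_gen s -> ~~ (mlead q < mlead p)%O].
  have [sJ|] := pselect {subset s <= J}; last by exists 0.
  have [p Jp sp] : exists2 p, p \in J & p \notin ideal_gen s.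
    apply: contrapT => nop; apply: nofg; exists s => p; apply/idP/idP; last first.
      exact: ideal_gen_min.
    by move=> Jp; apply: contraT => sp; case: nop; exists p.
  move: {-1}(mlead p) (erefl (mlead p)) => m.
  elim/(well_founded_ind (@ltom_wf V)): m p Jp sp => m IHm p Jp sp def_m.
  have [[q [Jq sq lt_q]]|noq] :=
    pselect (exists q, [/\ q \in J, q \notin ideal_gen s & (mlead q < mlead p)%O]).
    by apply: (IHm (mlead q) _ q) => //; rewrite -def_m.
  exists p => _; split=> // q Jq sq; apply/negP=> lt_q; apply: noq.
  by exists q.
have [f fP] := choice ex_p.
pose s k := iter k (fun s => rcons s (f s)) [::]; pose p k := f (s k).
have sJ k : {subset s k <= J}.
  elim: k => [//|k IHk] q; rewrite mem_rcons inE => /predU1P[->|/IHk//].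
  by case: (fP (s k) IHk).
have p_mem i j : (i < j)%N -> p i \in s j.
  elim: j => [//|j IHj]; rewrite ltnS leq_eqVlt /= mem_rcons inE.
  by case/predU1P=> [->|/IHj ->]; rewrite ?eqxx ?orbT.
have [i [j [lt_ij le_m]]] := dickson (fun k => mlead (p k)).
have [Jp sp p_min] := fP (s j) (sJ j).
have Jpi : p i \in J by case: (fP (s i) (sJ i)).
have pi_neq0 : p i != 0.
  case: (fP (s i) (sJ i)) => _ + _; rewrite -/(p i); apply: contraNneq => ->.
  by case: (ideal_gen_lin (s i)).
pose c := (p j)@_(mlead (p j)) / (p i)@_(mlead (p i)).
pose a := (mlead (p j) - mlead (p i))%MM.
have def_a : (a + mlead (p i))%MM = mlead (p j) by rewrite submK.
pose r := (c *: 'X_[a]) * p i.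
have sr : r \in ideal_gen (s j).
  by apply: (linM (ideal_gen_lin _)); apply: ideal_gen_mem; apply: p_mem.
have q_in : p j - r \notin ideal_gen (s j).
  apply: contra sp => sq; rewrite -/(p j) -(subrK r (p j)).
  by apply: (linD (ideal_gen_lin _)).
have Jq : p j - r \in J by apply: (linB HJ) => //; apply: (linM HJ).
have /negP[] := p_min _ Jq q_in; rewrite -/(p j).
have q_neq0 : p j - r != 0.
  by apply: contraNneq q_in => ->; case: (ideal_gen_lin (s j)).
have coefr : r@_(mlead (p j)) = (p j)@_(mlead (p j)).
  have Xp : ('X_[a] * p i)@_(mlead (p j)) = (p i)@_(mlead (p i)).
    by rewrite mulrC -{1}def_a; apply: mcoeffMX.
  rewrite /r -scalerAl mcoeffZ Xp divfK //.
  by rewrite mleadc_eq0.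
have le_q : (mlead (p j - r) <= mlead (p j))%O.
  apply: le_trans (mleadB_le _ _) _; rewrite leUx lexx /=.
  apply: le_trans (mleadM_le _ _) _.
  by rewrite -[X in (_ <= X)%O]def_a lemc_add2l -[X in (_ <= X)%O](mleadXm K) mleadZ_le.
rewrite lt_neqAle le_q andbT; apply/eqP=> eq_m.
have := mleadc_eq0 (p j - r); rewrite eq_m mcoeffB coefr subrr eqxx.
by rewrite (negPf q_neq0).
Qed.

Lemma noetherian_surj (R R' : comNzRingType) (f : {rmorphism R -> R'}) :
  (forall y, exists x, f x = y) -> noetherian R -> noetherian R'.
Proof.
move=> f_surj noethR J J_id; have HJ := idealr_lin J_id.
have [s Js] := noethR _ (contraction_closed f J_id).
exists (map f s) => y; apply/idP/idP; last first.
  apply: ideal_gen_min => // _ /mapP[r sr ->].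
  by have := ideal_gen_mem sr; rewrite -Js.
have [x <-] := f_surj y => Jx.
by apply: ideal_gen_map; rewrite -Js.
Qed.

(** * Zariski's lemma *)

Section FractionLift.
Variables (R : idomainType) (L : fieldType) (f : {rmorphism R -> L}).
Hypothesis f_inj : injective f.
Local Notation tofrac := (@FracField.tofrac R).

Lemma fractionP (z : {fraction R}) : exists a b, b != 0 /\ z * tofrac b = tofrac a.
Proof.
elim/quotW: z => x; exists \n_x, \d_x; split; first exact: denom_ratioP.
unlock tofrac; rewrite -[LHS]FracField.pi_mul; apply/eqmodP => /=.
rewrite FracField.equivfE /FracField.mulf /= !numden_Ratio ?mulf_neq0 ?oner_neq0 ?denom_ratioP //.
by rewrite !mulr1 mulrC.
Qed.

Lemma fraction_lift : exists g : {rmorphism {fraction R} -> L},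
  forall a, g (tofrac a) = f a.
Proof.
have f_eq0 a : (f a == 0) = (a == 0) by rewrite -(rmorph0 f) (inj_eq f_inj).
have [num numP] := choice fractionP; have [den denP] := choice numP.
pose g z := f (num z) / f (den z).
have g_char z a b : b != 0 -> z * tofrac b = tofrac a -> g z * f b = f a.
  move=> b_neq0 def_a; have [d_neq0 def_n] := denP z.
  have fd : f (den z) != 0 by rewrite f_eq0.
  apply: (mulIf fd); rewrite /g mulrAC divfK // -!rmorphM; congr (f _).
  by apply/eqP; rewrite -tofrac_eq !tofracM -def_a -def_n; apply/eqP; ring.
have gB : zmod_morphism g.
  move=> y z; have [dy Ny] := denP y; have [dz Nz] := denP z.
  have fy : f (den y) != 0 by rewrite f_eq0.
  have fz : f (den z) != 0 by rewrite f_eq0.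
  apply: (mulIf (mulf_neq0 fy fz)); rewrite -rmorphM.
  rewrite (g_char _ (num y * den z - num z * den y)) ?mulf_neq0 //.
    rewrite rmorphB !rmorphM mulrBl mulrA (g_char y (num y)) //.
    by rewrite [f (den y) * _]mulrC mulrA (g_char z (num z)).
  by rewrite tofracB !tofracM -Ny -Nz; ring.
have gM : monoid_morphism g.
  split=> [|y z].
    have := g_char 1 1 1 (oner_neq0 _); rewrite mul1r rmorph1 mulr1; exact.
  have [dy Ny] := denP y; have [dz Nz] := denP z.
  have fy : f (den y) != 0 by rewrite f_eq0.
  have fz : f (den z) != 0 by rewrite f_eq0.
  apply: (mulIf (mulf_neq0 fy fz)); rewrite -rmorphM.
  rewrite (g_char _ (num y * num z)) ?mulf_neq0 //.
    by rewrite !rmorphM mulrACA (g_char y (num y)) // (g_char z (num z)).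
  by rewrite !tofracM -Ny -Nz; ring.
pose gr : {rmorphism {fraction R} -> L} := HB.pack g
  (GRing.isZmodMorphism.Build _ _ g gB) (GRing.isMonoidMorphism.Build _ _ g gM).
exists gr => a; have := g_char (tofrac a) a 1 (oner_neq0 _).
by rewrite tofrac1 mulr1 rmorph1 mulr1; apply.
Qed.

Lemma clear_denominators (p : {poly {fraction R}}) :
  exists d q, d != 0 /\ tofrac d *: p = map_poly tofrac q.
Proof.
elim/poly_ind: p => [|p c [d [q [d_neq0 def_q]]]].
  by exists 1, 0; rewrite oner_neq0 scaler0 map_poly0.
have [a [b [b_neq0 def_a]]] := fractionP c.
exists (d * b), (b *: q * 'X + (d * a)%:P); rewrite mulf_neq0 //; split=> //.
rewrite [RHS]rmorphD [X in _ = X + _]rmorphM /= map_polyX map_polyC /= map_polyZ.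
rewrite -def_q !rmorphM /= -def_a scalerDr -!mul_polyC !polyCM; ring.
Qed.

(** Multiplying q(x) = 0 by c^(n-1), with c the leading coefficient and n the degree, gives a monic
    equation for c x. *)
Lemma integral_lead_coef (q : {poly R}) x :
  q != 0 -> root (map_poly f q) x -> integralOver f (f (lead_coef q) * x).
Proof.
move=> q_neq0; have szq : (0 < size q)%N by rewrite size_poly_gt0.
set c := lead_coef q; set n := (size q).-1.
have szn : size q = n.+1 by rewrite prednK.
pose r := \poly_(i < n.+1) (if i == n then 1 else q`_i * c ^+ (n.-1 - i)).
have lead_r : r`_n = 1 by rewrite coef_poly ltnSn eqxx.
have sz_r : size r = n.+1.
  by rewrite size_poly_eq // eqxx oner_neq0.
move=> /rootP qx0; exists r.
  by rewrite monicE lead_coefE sz_r lead_r.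
have c_neq0 : f c != 0 by rewrite -(rmorph0 f) (inj_eq f_inj) lead_coef_eq0.
apply/rootP; rewrite (@horner_coef_wide _ n.+1) ?(leq_trans (size_poly _ _)) ?sz_r //.
(* One more factor c turns r(c x) into c^n q(x) term by term, so the truncated [n.-1] does no harm
   at n = 0. *)
apply: (mulfI c_neq0); rewrite mulr0.
have sz_fq : (size (map_poly f q) <= n.+1)%N.
  by apply: leq_trans (size_poly _ _) _; rewrite szn.
transitivity (f c ^+ n * (map_poly f q).[x]); last by rewrite qx0 mulr0.
rewrite (horner_coef_wide _ sz_fq) !mulr_sumr.
apply: eq_bigr => -[i /= lt_i] _; rewrite !coef_map /= coef_poly lt_i.
case: eqP => [->|/eqP neq_in].
  by rewrite rmorph1 mul1r exprMn /c lead_coefE -/n; ring.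
rewrite exprMn rmorphM rmorphXn.
have -> : f c ^+ n = f c * f c ^+ (n.-1 - i) * f c ^+ i.
  rewrite -exprS -exprD; congr (_ ^+ _).
  by move: lt_i neq_in; lia.
ring.
Qed.

End FractionLift.

Section Zariski.

Inductive generated (F L : fieldType) (iota : F -> L) (xs : seq L) : L -> Prop :=
| Gen_const a : generated iota xs (iota a)
| Gen_var x : x \in xs -> generated iota xs x
| Gen_add x y : generated iota xs x -> generated iota xs y -> generated iota xs (x + y)
| Gen_mul x y : generated iota xs x -> generated iota xs y -> generated iota xs (x * y).

(* 1 + b X is prime to b, so its inverse cannot become integral over the
   integrally closed ring F[X] after multiplication by a power of b. *)
Lemma poly_not_field_after_inverting (F L : fieldType) (E : {rmorphism {poly F} -> L})
    (b : {poly F}) k :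
    injective E -> b != 0 ->
  ~ integralOver E (E b ^+ k / E (1 + b * 'X)).
Proof.
move=> E_inj b_neq0 [p p_monic /rootP]; set g := 1 + b * 'X.
have sz_g : (1 < size g)%N.
  have sz_bX : (1 < size (b * 'X)%R)%N by rewrite size_mulX // ltnS size_poly_gt0.
  by rewrite /g addrC size_polyDl ?size_poly1.
have g_neq0 : g != 0 by rewrite -size_poly_gt0 ltnW.
have Eg : E g != 0 by rewrite -(rmorph0 E) (inj_eq E_inj).
set n := (size p).-1; have sz_p : size p = n.+1.
  by rewrite prednK // size_poly_gt0 monic_neq0.
have sz_Ep : (size (map_poly E p) <= n.+1)%N.
  by apply: leq_trans (size_poly _ _) _; rewrite sz_p.
rewrite (horner_coef_wide _ sz_Ep) => /(congr1 (fun z => E g ^+ n * z)).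
rewrite mulr0 mulr_sumr.
rewrite (eq_bigr (fun i : 'I_n.+1 => E (p`_i * b ^+ (k * i) * g ^+ (n - i)))); last first.
  move=> [i /=]; rewrite ltnS => le_in _; rewrite coef_map /= !rmorphM !rmorphXn /=.
  have -> : E g ^+ n = E g ^+ (n - i) * E g ^+ i by rewrite -exprD subnK.
  rewrite exprMn exprVn exprM; move: (expf_neq0 i Eg).
  by move: (E g ^+ i) => v v_neq0; field.
rewrite -rmorph_sum -(rmorph0 E) => /E_inj.
rewrite big_ord_recr /= subnn expr0 mulr1.
have -> : p`_n = 1 by have := monicP p_monic; rewrite lead_coefE.
rewrite mul1r => /eqP; rewrite addrC addr_eq0 => /eqP def_b.
have g_dvd : g %| b ^+ (k * n).
  rewrite def_b dvdpNr; apply: (big_ind (fun u => g %| u)) => [|u v|i _]; first exact: dvdp0.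
    exact: dvdp_add.
  rewrite dvdp_mull // -(subnSK (ltn_ord i)) exprS dvdp_mulr //.
have g_coprime : coprimep g (b ^+ (k * n)).
  rewrite coprimep_expr // /g addrC.
  apply/Bezout_eq1_coprimepP; exists (1, - 'X) => /=.
  by rewrite mul1r mulNr [b * _]mulrC addrAC subrr add0r.
have := dvdp_gcd_idl g_dvd => /eqp_size.
by move: g_coprime; rewrite /coprimep => /eqP -> sz1; rewrite -sz1 in sz_g.
Qed.

(** Induction on the number of generators, over all base fields. If x were transcendental, L would
    be generated over F(x) by the other generators, which are algebraic over F(x) by induction. One
    b in F[x] then makes every element of L integral over F[x] after multiplication by a power of b,
    and this fails for the inverse of 1 + b x. *)
Theorem zariski n (F L : fieldType) (iota : {rmorphism F -> L}) (xs : seq L) :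
    size xs = n -> (forall y, generated iota xs y) ->
  {in xs, forall x, algebraicOver iota x}.
Proof.
elim: n F iota xs => [|n IHn] F iota xs sz_xs gen_xs x xs_x.
  by rewrite (size0nil sz_xs) in xs_x.
apply: contrapT => x_trans.
pose E : {rmorphism {poly F} -> L} := horner_eval x \o map_poly iota.
have EE p : E p = (map_poly iota p).[x] by [].
have E_inj : injective E.
  apply: raddf_inj => p Ep0; apply/eqP; apply: contrapT => /negP p_neq0.
  by apply: x_trans; exists p => //; apply/rootP.
have EX : E 'X = x by rewrite EE map_polyX hornerX.
have EC a : E a%:P = iota a by rewrite EE map_polyC hornerC.
have [Phi PhiE] := fraction_lift E_inj.
pose xs' := rem x xs.
have xsE y : y \in xs -> y = x \/ y \in xs'.
  rewrite (perm_mem (perm_to_rem xs_x)) inE.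
  by case/predU1P=> [|xs'_y]; [left|right].
have gen_xs' y : generated Phi xs' y.
  elim: (gen_xs y) => [a|z /xsE[->|xs'_z]|u v _ IHu _ IHv|u v _ IHu _ IHv].
  - by rewrite -EC -PhiE; apply: Gen_const.
  - by rewrite -EX -PhiE; apply: Gen_const.
  - exact: Gen_var.
  - exact: Gen_add.
  - exact: Gen_mul.
have sz_xs' : size xs' = n by rewrite size_rem // sz_xs.
have alg_xs' := IHn _ Phi xs' sz_xs' gen_xs'.
have int_c z : z \in xs' -> exists2 c, c != 0 & integralOver E (E c * z).
  move/alg_xs'=> [p p_neq0 /rootP pz0].
  have [d [q [d_neq0 def_q]]] := clear_denominators p.
  have q_neq0 : q != 0.
    apply: contraNneq p_neq0 => q0; move/eqP: def_q.
    by rewrite q0 map_poly0 scaler_eq0 tofrac_eq0 (negPf d_neq0).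
  exists (lead_coef q); first by rewrite lead_coef_eq0.
  apply: integral_lead_coef => //; apply/rootP.
  have -> : map_poly E q = map_poly Phi (map_poly (@FracField.tofrac _) q).
    by rewrite -map_poly_comp; apply: eq_map_poly => a /=; rewrite PhiE.
  by rewrite -def_q map_polyZ hornerZ pz0 mulr0.
have [b b_neq0 int_b] : exists2 b, b != 0 & forall z, z \in xs' -> integralOver E (E b * z).
  elim: (xs') int_c => [|z zs IHzs] int_c; first by exists 1; rewrite ?oner_neq0.
  have [|b b_neq0 int_b] := IHzs.
    by move=> y zs_y; apply: int_c; rewrite inE zs_y orbT.
  have [c c_neq0 int_cz] := int_c z (mem_head _ _).
  exists (b * c); first by rewrite mulf_neq0.
  move=> y; rewrite inE rmorphM => /predU1P[->|/int_b int_y].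
    by rewrite -mulrA; apply: integral_mul => //; apply: integral_id.
  by rewrite mulrAC mulrC; apply: integral_mul => //; apply: integral_id.
have int_y y : exists k, integralOver E (E b ^+ k * y).
  have int_bk k : integralOver E (E b ^+ k) by rewrite -rmorphXn; apply: integral_id.
  elim: (gen_xs y) => [a|z /xsE[->|/int_b int_z]|u v _ [k int_u] _ [l int_v]|
    u v _ [k int_u] _ [l int_v]].
  - by exists 0%N; rewrite expr0 mul1r -EC; apply: integral_id.
  - by exists 0%N; rewrite expr0 mul1r -EX; apply: integral_id.
  - by exists 1%N.
  - exists (k + l)%N; rewrite mulrDr exprD; apply: integral_add.
      by rewrite mulrAC mulrC; apply: integral_mul.
    by rewrite -mulrA; apply: integral_mul.
  - by exists (k + l)%N; rewrite exprD mulrACA; apply: integral_mul.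
have [k] := int_y (E (1 + b * 'X))^-1.
exact: poly_not_field_after_inverting.
Qed.

End Zariski.

Lemma residue_field (R : comNzRingType) (M : {pred R}) : maximal_ideal M ->
  exists (L : fieldType) (pi : {rmorphism R -> L}),
    (forall y, exists r, pi r = y) /\ forall r, (pi r == 0) = (r \in M).
Proof.
move=> M_max; have M_id : idealr_closed M by case: M_max.
have HM := idealr_lin M_id.
pose I : idealr R := HB.pack (M : R -> bool) (isIdealr.Build R M M_id).
pose Q : comNzRingType := {ideal_quot I}.
pose pi : {rmorphism R -> Q} := \pi_{ideal_quot I}%qT.
have pi_surj y : exists r, pi r = y by exists (repr y); apply: reprK.
have pi_eq0 r : (pi r == 0) = (r \in M).
  by rewrite -(rmorph0 pi) /pi /= -Quotient.idealrBE subr0.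
(* Inverses in R/M are picked by choice; the default 0 serves 0 itself, as the field structure
   requires. *)
pose inv (y : Q) := if pselect (exists z, z * y = 1) is left e then projT1 (cid e) else 0.
have mulV y : y != 0 -> inv y * y = 1.
  move=> y_neq0; rewrite /inv; case: pselect => [e|[]]; first by case: (cid e).
  have [r def_y] := pi_surj y; have Mr : r \notin M by rewrite -pi_eq0 def_y.
  have /adjoinP[a Ma] : 1 \in adjoin M r.
    apply: contraT => adj1; case/negP: Mr.
    have [_ M_maximal] := M_max.
    apply: (M_maximal (adjoin M r)) (adjoin_self _ HM); last exact: adjoin_sub.
    by have [H0 H1] := adjoin_lin r HM; split.
  exists (pi a); rewrite -def_y; apply/eqP.
  rewrite -rmorphM -(rmorph1 pi) eq_sym -subr_eq0 -rmorphB.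
  by rewrite pi_eq0.
have inv0 : inv 0 = 0.
  rewrite /inv; case: pselect => // e; exfalso; case: e => z z0.
  by have := oner_neq0 Q; rewrite -z0 mulr0 eqxx.
pose L : fieldType := HB.pack (GRing.ComNzRing.sort Q)
  (GRing.ComNzRing_isField.Build (GRing.ComNzRing.sort Q) mulV inv0).
by exists L, pi.
Qed.

(** * Syzygies with a standard complement *)

Section SupportedVectors.
Variables (K : fieldType) (V : nat).
Local Notation S := {mpoly K[V]}.
Local Notation mnm := 'X_{1..V}.

Definition supp_in r (P : 'I_r -> pred mnm) (v : 'rV[S]_r) :=
  forall g m, m \in msupp (v 0 g) -> P g m.

Variable r : nat.
Implicit Types (P Q : 'I_r -> pred mnm) (u v : 'rV[S]_r).

Lemma supp_in0 P : supp_in P 0.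
Proof. by move=> g m; rewrite mxE msupp0. Qed.

Lemma supp_inD P u v : supp_in P u -> supp_in P v -> supp_in P (u + v).
Proof.
move=> Pu Pv g m; rewrite mxE => /msuppD_le.
by rewrite mem_cat => /orP[/Pu|/Pv].
Qed.

Lemma supp_inN P v : supp_in P v -> supp_in P (- v).
Proof. by move=> Pv g m; rewrite mxE (perm_mem (msuppN _)) => /Pv. Qed.

Lemma supp_inB P u v : supp_in P u -> supp_in P v -> supp_in P (u - v).
Proof. by move=> Pu Pv; apply: supp_inD => //; apply: supp_inN. Qed.

Lemma supp_inS P Q v :
  (forall g m, P g m -> Q g m) -> supp_in P v -> supp_in Q v.
Proof. by move=> sPQ Pv g m /Pv /sPQ. Qed.

Lemma supp_in_term P c g m :
  P g m -> supp_in P ((c *: 'X_[m]) *: delta_mx 0 g).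
Proof.
move=> Pgm g' m'; rewrite !mxE eqxx /=.
case: eqP => [->|_]; last by rewrite mulr0 msupp0.
by rewrite mulr1 => /msuppZ_le /mem_msuppXP <-.
Qed.

Lemma supp_inZ P Q c m v :
    (forall g m', Q g m' -> P g (m + m')%MM) ->
  supp_in Q v -> supp_in P ((c *: 'X_[m]) *: v).
Proof.
move=> sQP Qv g m'; rewrite mxE => /msuppM_le /allpairsP[[m1 m2]] /= [].
by move=> /msuppZ_le /mem_msuppXP <- /Qv /sQP + ->.
Qed.

Lemma row_termE v : v = \sum_g \sum_(m <- msupp (v 0 g))
  ((v 0 g)@_m *: 'X_[m]) *: delta_mx 0 g.
Proof.
rewrite {1}[v]row_sum_delta; apply: eq_bigr => g _.
by rewrite -scaler_suml -mpolyE.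
Qed.

Lemma supp_in_ind P (Q : 'rV[S]_r -> Prop) :
    Q 0 -> (forall u v, Q u -> Q v -> Q (u + v)) ->
    (forall c g m, P g m -> Q ((c *: 'X_[m]) *: delta_mx 0 g)) ->
  forall v, supp_in P v -> Q v.
Proof.
move=> Q0 QD Qt v Pv; rewrite [v]row_termE; apply: big_ind => // g _.
by rewrite big_seq; apply: big_ind => // m /Pv; apply: Qt.
Qed.

End SupportedVectors.

Section SyzygyStep.
(* N is a submodule of S^r that meets the span of the standard terms trivially.
   The h-th element of N has leading term X^(l h) e_(gi h) and tail s h; the
   monomials m with std' h m are those for which X^m times that element is used
   to rewrite X^m X^(l h) e_(gi h).  The measure mu makes this terminate. *)
Variables (K : fieldType) (V : nat).
Local Notation S := {mpoly K[V]}.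
Local Notation mnm := 'X_{1..V}.
Variables (r r' : nat) (std : 'I_r -> pred mnm) (N : 'rV[S]_r -> Prop).
Variables (gi : 'I_r' -> 'I_r) (l : 'I_r' -> mnm) (std' : 'I_r' -> pred mnm).
Variables (s : 'I_r' -> 'rV[S]_r) (q : nat) (mu : mnm -> nat).

Definition submodule (M : 'rV[S]_r -> Prop) :=
  M 0 /\ forall a u v, M u -> M v -> M (a *: u + v).

Definition lead_minus_tail h := 'X_[l h] *: delta_mx 0 (gi h) - s h.
Definition step_mx : 'M[S]_(r', r) := \matrix_h lead_minus_tail h.

Hypothesis N_sub : submodule N.
Hypothesis N_std0 : forall v, N v -> supp_in std v -> v = 0.
Hypothesis s_deg : forall h, supp_in (fun _ m => mdeg m == q) (s h).
Hypothesis l_deg : forall h, mdeg (l h) = q.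
Hypothesis N_gen : forall h, N (lead_minus_tail h).
Hypothesis lead_cover : forall g m, ~~ std g m ->
  exists h m', [/\ gi h = g, m = (l h + m')%MM & std' h m'].
Hypothesis lead_uniq : forall h h2 m m2, std' h m -> std' h2 m2 ->
  gi h = gi h2 -> (l h + m = l h2 + m2)%MM -> h = h2.
Hypothesis lead_nstd : forall h m, std' h m -> ~~ std (gi h) (l h + m)%MM.
Hypothesis tail_dec : forall h m g m', std' h m -> m' \in msupp (s h 0 g) ->
  std g (m + m')%MM \/ (mu (m + m')%MM < mu (l h + m)%MM)%N.

Lemma mul_step_mx v : v *m step_mx = \sum_h v 0 h *: lead_minus_tail h.
Proof. by rewrite mulmx_sum_row; apply: eq_bigr => h _; rewrite rowK. Qed.

Lemma submoduleD u v : N u -> N v -> N (u + v).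
Proof. by move=> Nu Nv; rewrite -[u]scale1r; apply: N_sub.2. Qed.

Lemma submoduleZ a u : N u -> N (a *: u).
Proof. by move=> Nu; rewrite -[a *: u]addr0; apply: N_sub.2 => //; case: N_sub. Qed.

Lemma step_mx_sub v : N (v *m step_mx).
Proof.
rewrite mul_step_mx; apply: big_ind => [||h _]; first by case: N_sub.
  exact: submoduleD.
exact: submoduleZ.
Qed.

(** Division by the rows of [step_mx]: a nonstandard term is replaced by its tail, whose nonstandard
    terms have smaller [mu]. Leads and tails all have degree q, so any condition [Hm] on degrees
    passes to w; it serves for homogeneity as well as for degree bounds. *)
Lemma step_reduce (Hm : pred nat) n v :
    supp_in (fun g m => std g m || (mu m < n)%N) v ->
    supp_in (fun _ m => Hm (mdeg m)) v ->
  exists w, [/\ supp_in std' w, supp_in (fun _ m => Hm (q + mdeg m)%N) w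
              & supp_in std (v - w *m step_mx)].
Proof.
elim: n v => [|n IHn] v.
  move=> v_std _; exists 0; split; try exact: supp_in0.
  rewrite mul0mx subr0; apply: supp_inS v_std => g m.
  by rewrite orbF.
move=> v_std v_deg.
pose P g m := (std g m || (mu m < n.+1)%N) && Hm (mdeg m).
have {v_std v_deg}: supp_in P v by move=> g m gm; apply/andP; split; eauto.
move: v; apply: supp_in_ind => [|u v [w1 [A1 B1 C1]] [w2 [A2 B2 C2]]|c g m].
- by exists 0; split; rewrite ?mul0mx ?subr0; apply: supp_in0.
- exists (w1 + w2); split; try exact: supp_inD.
  by rewrite mulmxDl opprD addrACA; apply: supp_inD.
- rewrite /P; have [gm_std _|gm_nstd] := boolP (std g m).
    exists 0; split; try exact: supp_in0.
    by rewrite mul0mx subr0; apply: supp_in_term.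
  case/andP=> /= mu_m deg_m.
  have [h [m' [gh def_m m'_std]]] := lead_cover gm_nstd.
  pose u := (c *: 'X_[m']) *: s h.
  have [||w [w_std w_deg uw_std]] := IHn u.
  + move=> g' m2; rewrite mxE => /msuppM_le /allpairsP[[m3 m4]] /= [].
    move=> /msuppZ_le /mem_msuppXP <- m4s ->.
    have [->//|lt_mu] := tail_dec m'_std m4s.
    by rewrite orbC (leq_trans lt_mu) // -ltnS -def_m.
  + apply: supp_inZ (@s_deg h) => g' m2 /eqP deg_m2.
    by rewrite mdegD deg_m2 addnC -(l_deg h) -mdegD -def_m.
  exists (w + (c *: 'X_[m']) *: delta_mx 0 h); split.
  + by apply: supp_inD => //; apply: supp_in_term.
  + apply: supp_inD => //; apply: supp_in_term.
    by rewrite -(l_deg h) -mdegD -def_m.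
  + rewrite mulmxDl -scalemxAl -rowE rowK /lead_minus_tail scalerBr -/u.
    rewrite scalerA gh -scalerAl -mpolyXD addmC -def_m.
    by rewrite opprD opprB addrCA [_ + (u - _)]addrC subrK addrC.
Qed.

Lemma supp_in_bound (v : 'rV[S]_r) : exists n, supp_in (fun g m => std g m || (mu m < n)%N) v.
Proof.
exists (\max_(g < r) \max_(m <- msupp (v 0%R g)) (mu m).+1) => g m gm.
apply/orP; right; apply: leq_trans (leq_bigmax g).
by rewrite (big_rem m) //= leq_maxl.
Qed.

Lemma step_reduce_sub (Hm : pred nat) v :
    N v -> supp_in (fun _ m => Hm (mdeg m)) v ->
  exists w, [/\ supp_in std' w, supp_in (fun _ m => Hm (q + mdeg m)%N) w
              & v = w *m step_mx].
Proof.
move=> Nv v_deg; have [n vn] := supp_in_bound v.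
have [w [w_std w_deg vw]] := step_reduce vn v_deg.
exists w; split=> //; apply/eqP; rewrite -subr_eq0; apply/eqP.
apply: N_std0 vw; rewrite addrC -scaleN1r; apply: N_sub.2 => //.
exact: step_mx_sub.
Qed.

Lemma step_mx_image v : N v <-> exists w, v = w *m step_mx.
Proof.
split=> [Nv|[w ->]]; last exact: step_mx_sub.
by have [|w [_ _ ->]] := @step_reduce_sub predT v Nv; [|exists w].
Qed.

(** A term of w whose lead has the largest [mu] cannot cancel: other leads differ by [lead_uniq],
    and tails are standard or smaller. *)
Lemma step_mx_inj w : supp_in std' w -> w *m step_mx = 0 -> w = 0.
Proof.
move=> w_std w0.
suff Hn n : (forall h m, m \in msupp (w 0 h) -> (mu (l h + m)%MM < n)%N) ->
    w = 0.
  apply: (Hn (\max_(h < r') \max_(m <- msupp (w 0%R h)) (mu (l h + m)%MM).+1)) => h m hm.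
  by apply: leq_trans (leq_bigmax h); rewrite (big_rem m) //= leq_maxl.
elim: n => [|n IHn] le_mu.
  apply/rowP=> h; rewrite [RHS]mxE; apply: msuppnil0.
  by case def_w: (msupp _) (le_mu h) => [//|m ?] /(_ m (mem_head _ _)).
apply: IHn => h0 m0 hm0; have := le_mu _ _ hm0.
rewrite ltnS leq_eqVlt => /orP[/eqP mu_n|//]; exfalso.
set g := gi h0; set M := (l h0 + m0)%MM in mu_n.
have /(congr1 (mcoeff M)) : (w *m step_mx) 0 g = 0 by rewrite w0 mxE.
rewrite mul_step_mx summxE raddf_sum (bigD1 h0) //= big1 => [|h neq_h].
  rewrite mcoeff0 addr0 !mxE !eqxx /= mulr1 mulrBr mcoeffB /M.
  rewrite mcoeffMX [X in _ - X]memN_msupp_eq0 => [/eqP|].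
    by rewrite subr0; apply/negP; rewrite -mcoeff_msupp.
  apply/negP=> /msuppM_le /allpairsP[[m1 m2]] /= [wm1 sm2].
  rewrite -/M => def_M; have w_m1 := w_std _ _ wm1.
  have := tail_dec w_m1 sm2; rewrite -def_M => -[].
    by apply/negP; apply: lead_nstd; apply: w_std.
  by rewrite mu_n ltnNge -ltnS le_mu.
rewrite !mxE eqxx mulrBr mcoeffB [X in _ - X]memN_msupp_eq0 ?subr0.
  case: eqP => [eq_g|]; last by rewrite mulr0 mulr0 mcoeff0.
  rewrite mulr1 memN_msupp_eq0 //; apply/negP=> /msuppM_le /allpairsP[[m1 m2]] /=.
  case=> wm1 /mem_msuppXP <-; rewrite [(m1 + _)%MM]addmC => def_M.
  by case/eqP: neq_h; apply: lead_uniq (w_std _ _ wm1) (w_std _ _ hm0) _ _.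
apply/negP=> /msuppM_le /allpairsP[[m1 m2]] /= [wm1 sm2] def_M.
have := tail_dec (w_std _ _ wm1) sm2; rewrite -def_M => -[].
  by apply/negP; apply: lead_nstd; apply: w_std.
by rewrite mu_n ltnNge -ltnS le_mu.
Qed.

(** The image of X^m e_h lies in N, so it is also the image of a combination with multipliers in
    [std']; the difference is a syzygy. With [step_mx_inj], the terms in [std'] thus span a
    complement of the syzygies, which is what the next step starts from. *)
Lemma step_mx_ker_decomp h m : exists w,
  [/\ supp_in std' w, supp_in (fun _ m' => mdeg m' == mdeg m) w
    & ('X_[m] *: delta_mx 0 h - w) *m step_mx = 0].
Proof.
have rh : delta_mx 0 h *m step_mx = lead_minus_tail h by rewrite -rowE rowK.
pose v := 'X_[m] *: lead_minus_tail h.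
have Nv : N v by apply: submoduleZ.
have [|w [w_std w_deg def_v]] := @step_reduce_sub (pred1 (q + mdeg m)%N) v Nv.
  rewrite /v /lead_minus_tail scalerBr scalerA -mpolyXD.
  rewrite -['X_[m]]scale1r -['X_[_ + _]]scale1r; apply: supp_inB.
    by apply: supp_in_term; rewrite /= mdegD l_deg addnC.
  apply: supp_inZ (@s_deg h) => g m' /eqP deg_m'.
  by rewrite /= mdegD deg_m' addnC.
exists w; split=> //; last first.
  by rewrite mulmxBl -def_v -scalemxAl rh subrr.
by move=> g m' /w_deg; rewrite /= eqn_add2l.
Qed.

Lemma step_mx_homog h g : step_mx h g \is q.-homog.
Proof.
rewrite !mxE eqxx; apply: rpredB.
  case: eqP => _; last by rewrite mulr0 rpred0.
  by rewrite mulr1 dhomogX; apply/eqP; apply: l_deg.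
by apply/dhomogP=> m /s_deg /eqP.
Qed.

Lemma step_mx_deg (Hm : pred nat) (w : 'rV[S]_r') :
  supp_in (fun _ m => Hm (q + mdeg m)%N) w ->
  supp_in (fun _ m => Hm (mdeg m)) (w *m step_mx).
Proof.
move: w; apply: supp_in_ind => [|u v Hu Hv|c h m deg_m].
- by rewrite mul0mx; apply: supp_in0.
- by rewrite mulmxDl; apply: supp_inD.
- rewrite -scalemxAl -rowE.
  apply: (@supp_inZ _ _ _ _ (fun _ m' => mdeg m' == q)) => [g m' /eqP q_m'|g m'].
    by rewrite mdegD q_m' addnC.
  rewrite mxE => hm'; have /dhomogP homog_D := step_mx_homog h g.
  by apply/eqP/homog_D.
Qed.

End SyzygyStep.

(** * Standard monomials in the z-variables *)

Section StandardMonomials.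
Variables (V : nat) (isz : pred 'I_V).
Local Notation mnm := 'X_{1..V}.
Implicit Types (m : mnm) (v : 'I_V).

Definition zdeg m := (\sum_(v | isz v) m v)%N.
Definition zbounded k m := [forall v, (isz v && (m v != 0)) ==> (k <= v)]%N.
(* Decreases when a z-variable is replaced by a later one or by a P-variable, and
   when the number of z-variables drops from at least 2 to at most 1: this is
   what the term V.*2 is for. *)
Definition zweight m := (\sum_(v | isz v) m v * (V.*2 - v))%N.

Lemma zboundedP k m :
  reflect (forall v, isz v -> m v != 0%N -> (k <= v)%N) (zbounded k m).
Proof.
apply: (iffP forallP) => [H v zv mv|H v].
  by have /implyP := H v; rewrite zv mv; apply.
by apply/implyP=> /andP[zv mv]; apply: H.
Qed.

Lemma zdegD m1 m2 : zdeg (m1 + m2)%MM = (zdeg m1 + zdeg m2)%N.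
Proof. by rewrite -big_split; apply: eq_bigr => v _; rewrite mnmDE. Qed.

Lemma zdeg1 v : zdeg U_(v)%MM = isz v.
Proof.
rewrite /zdeg big_mkcond (bigD1 v) //= big1 => [|u neq_uv].
  by rewrite addn0 mnm1E eqxx; case: (isz v).
by rewrite mnm1E eq_sym (negPf neq_uv); case: (isz u).
Qed.

Lemma zweightD m1 m2 : zweight (m1 + m2)%MM = (zweight m1 + zweight m2)%N.
Proof. by rewrite -big_split; apply: eq_bigr => v _; rewrite mnmDE mulnDl. Qed.

Lemma zweight1 v : zweight U_(v)%MM = if isz v then (V.*2 - v)%N else 0%N.
Proof.
rewrite /zweight big_mkcond (bigD1 v) //= big1 => [|u neq_uv].
  by rewrite addn0 mnm1E eqxx mul1n.
by rewrite mnm1E eq_sym (negPf neq_uv) mul0n; case: (isz u).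
Qed.

Lemma zweight_le m : (zweight m <= V.*2 * zdeg m)%N.
Proof.
rewrite /zweight /zdeg big_distrr; apply: leq_sum => v _ /=.
by rewrite mulnC leq_mul2r leq_subr orbT.
Qed.

Lemma zbounded_min m v0 : isz v0 -> m v0 != 0%N ->
  exists v, [/\ isz v, m v != 0%N, (v <= v0)%N & zbounded v m].
Proof.
move=> zv0 mv0; pose P v := isz v && (m v != 0%N).
have Pv0 : P v0 by rewrite /P zv0.
case: (arg_minnP (@nat_of_ord V) Pv0) => v /andP[zv mv] v_min.
exists v; split=> //; first exact: v_min.
by apply/zboundedP=> u zu mu; apply: v_min; rewrite /P zu.
Qed.

Lemma zbounded_subm k m1 m2 : zbounded k (m1 + m2)%MM -> zbounded k m2.
Proof.
move=> /zboundedP H; apply/zboundedP=> v zv mv; apply: H => //.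
by rewrite mnmDE; lia.
Qed.

(** u is recovered from U_(u) + m as its z-variable of least index. *)
Lemma zbounded_lead_uniq u1 u2 m1 m2 :
    isz u1 -> isz u2 -> zbounded u1 m1 -> zbounded u2 m2 ->
  (U_(u1) + m1 = U_(u2) + m2)%MM -> u1 = u2.
Proof.
move=> zu1 zu2 /zboundedP b1 /zboundedP b2 /mnmP eqm.
apply/val_inj/anti_leq/andP; split=> /=.
  have [-> //|neq_u] := eqVneq u1 u2.
  have := eqm u2; rewrite !mnmDE !mnm1E eqxx (negPf neq_u) => eqm2.
  by apply: b1 => //; lia.
have [-> //|neq_u] := eqVneq u1 u2.
have := eqm u1; rewrite !mnmDE !mnm1E eqxx eq_sym (negPf neq_u) => eqm1.
by apply: b2 => //; lia.
Qed.

Lemma mnm_split m v : m v != 0%N -> exists m', m = (U_(v) + m')%MM.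
Proof.
move=> mv; exists (m - U_(v))%MM.
by rewrite addmC submK // lep1mP.
Qed.

Lemma zdeg_gt0 m : (0 < zdeg m)%N -> exists2 v, isz v & m v != 0%N.
Proof.
move=> m_gt0; apply: contrapT => H; move: m_gt0; rewrite /zdeg big1 // => v zv.
by apply/eqP; apply: contrapT => /negP mv; case: H; exists v.
Qed.

End StandardMonomials.

(** * Iterated linear syzygies *)

Section LinearSyzygies.
Variables (K : fieldType) (V : nat) (isz : pred 'I_V).
Local Notation S := {mpoly K[V]}.
Local Notation mnm := 'X_{1..V}.

(* lmin g bounds from below the z-variables allowed in standard terms at e_g. *)
Record level := Level {
  lrank : nat; lmin : 'I_lrank -> nat; lsub : 'rV[S]_lrank -> Prop }.

Definition lstd L (g : 'I_(lrank L)) : pred mnm := zbounded isz (lmin g).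

(** A direct sum decomposition of the free module, required for single terms but within their
    degree: this makes the tails of the next generators homogeneous. *)
Definition free_complement L :=
  [/\ submodule (@lsub L),
      forall v, lsub v -> supp_in (@lstd L) v -> v = 0
    & forall g m, exists w, [/\ supp_in (@lstd L) w,
        supp_in (fun _ m' => mdeg m' == mdeg m) w
      & lsub ('X_[m] *: delta_mx 0 g - w)]].

(** A nonstandard term at e_g is divided by its least z-variable z_c, where c < lmin g; the cofactor
    has z-variables of index at least c only. This makes the lead unique and gives the next bound
    c. *)
Lemma next_level L : free_complement L ->
  exists L' (D : 'M[S]_(lrank L', lrank L)),
  [/\ free_complement L', forall h g, D h g \is 1.-homog,
      forall v, lsub v <-> exists w, v = w *m D
    & forall v, @lsub L' v <-> v *m D = 0].
Proof.
case=> L_sub L_uniq L_ex.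
pose H : finType :=
  {p : 'I_V * 'I_(lrank L) | isz p.1 && (p.1 < lmin p.2)%N}.
pose c (h : 'I_#|H|) := (val (enum_val h)).1.
pose gi (h : 'I_#|H|) := (val (enum_val h)).2.
have zc h : isz (c h) by case/andP: (valP (enum_val h)).
have c_lt h : (c h < lmin (gi h))%N by case/andP: (valP (enum_val h)).
pose l h : mnm := U_(c h)%MM.
pose std' h := zbounded isz (c h) : pred mnm.
have [s s_prop] := choice (fun h => L_ex (gi h) (l h)).
have s_std h : supp_in (@lstd L) (s h) by case: (s_prop h).
have s_deg h : supp_in (fun _ m => mdeg m == 1%N) (s h).
  by case: (s_prop h) => _ + _; rewrite mdeg1.
have l_deg h : mdeg (l h) = 1%N by rewrite mdeg1.
have N_gen h : lsub (lead_minus_tail gi l s h) by case: (s_prop h).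
have lead_cover g m : ~~ lstd g m ->
    exists h m', [/\ gi h = g, m = (l h + m')%MM & std' h m'].
  rewrite negb_forall => /existsP[v0]; rewrite negb_imply -ltnNge.
  case/andP=> /andP[zv0 mv0] v0_lt.
  have [v [zv mv le_vv0 v_min]] := zbounded_min zv0 mv0.
  have [m' def_m] := mnm_split mv.
  have Hv : isz v && (v < lmin g)%N by rewrite zv (leq_ltn_trans le_vv0).
  exists (enum_rank (exist _ (v, g) Hv : H)), m'.
  rewrite /gi /l /std' /c enum_rankK /=; split=> //.
  by apply: zbounded_subm (U_(v)%MM) _ _; rewrite -def_m.
have lead_uniq h h2 m m2 : std' h m -> std' h2 m2 ->
    gi h = gi h2 -> (l h + m = l h2 + m2)%MM -> h = h2.
  move=> hm hm2 eq_g /(zbounded_lead_uniq (zc h) (zc h2) hm hm2) eq_c.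
  apply/enum_val_inj/val_inj.
  move: eq_c eq_g; rewrite /c /gi.
  by case: (val (enum_val h)) (val (enum_val h2)) => [? ?] [? ?] /= -> ->.
have lead_nstd h m : std' h m -> ~~ lstd (gi h) (l h + m)%MM.
  move=> _; apply/zboundedP=> /(_ (c h) (zc h)).
  by rewrite mnmDE mnm1E eqxx leqNgt c_lt => /(_ isT).
have tail_dec h m g m' : std' h m -> m' \in msupp (s h 0 g) ->
    lstd g (m + m')%MM \/
    (zweight isz (m + m')%MM < zweight isz (l h + m)%MM)%N.
  move=> /zboundedP hm sm'; have /zboundedP gm' := s_std _ _ _ sm'.
  have /mdeg1P[v /eqP def_m'] := s_deg _ _ _ sm'.
  rewrite {m' sm'}def_m' in gm' *.
  (* A P-variable v has weight 0. A z-variable v satisfies lmin g <= v; if the product is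
     nonstandard, some z-variable v0 of m has c <= v0 < lmin g, so v comes after c and weighs
     less. *)
  have [std_m|nstd_m] := boolP (lstd g (m + U_(v))%MM); [by left|right].
  rewrite !zweightD !zweight1 zc addnC ltn_add2r.
  case zv: (isz v); last by have := ltn_ord (c h); lia.
  move: nstd_m; rewrite negb_forall => /existsP[v0]; rewrite negb_imply -ltnNge.
  case/andP=> /andP[zv0]; rewrite mnmDE => mv0 v0_lt.
  have le_gv : (lmin g <= v)%N by apply: gm' => //; rewrite mnm1E eqxx.
  have neq_v : v != v0 by apply: contraTneq v0_lt => <-; rewrite -leqNgt.
  move: mv0; rewrite mnm1E (negPf neq_v) addn0 => /(hm _ zv0) le_cv0.
  by have := ltn_ord v; lia.
pose D := step_mx gi l s.
exists (@Level #|H| c (fun v => v *m D = 0)), D; split=> //.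
- split=> [|v vD v_std|h m].
  + split=> [|a u v uD vD]; first by rewrite /= mul0mx.
    by rewrite /= mulmxDl -scalemxAl uD vD scaler0 addr0.
  + exact: (step_mx_inj lead_uniq lead_nstd tail_dec) vD.
  + exact: (step_mx_ker_decomp L_sub L_uniq s_deg l_deg N_gen lead_cover tail_dec).
- exact: step_mx_homog.
- exact: (step_mx_image L_sub L_uniq s_deg l_deg N_gen lead_cover tail_dec).
Qed.

Variable I : {pred S}.
Hypothesis I_closed : 0 \in I /\ forall a, {in I &, forall u v, a * u + v \in I}.
Hypothesis I_quad : forall a b, isz a -> isz b -> exists s : S,
  [/\ s \is 2.-homog, {in msupp s, forall m, zdeg isz m <= 1}%N
    & 'X_a * 'X_b - s \in I].
Hypothesis I_std0 : forall p : S, p \in I ->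
  {in msupp p, forall m, zdeg isz m <= 1}%N -> p = 0.

Let std1 (_ : 'I_1) : pred mnm := fun m => (zdeg isz m <= 1)%N.
Let N1 (v : 'rV[S]_1) : Prop := v 0 0 \in I.

(** This step is not an instance of [next_level], as its standard terms are bounded in z-degree and
    not in the index of their variables. Each lead X_a X_b takes the two least z-variables of a
    nonstandard monomial, so multipliers have z-variables of index at least b: this starts the
    iteration. The last clause feeds [normal_form]. *)
Lemma base_level : exists r (gi : 'I_r -> 'I_1) (l : 'I_r -> mnm)
    (std' : 'I_r -> nat) s (D := step_mx gi l s),
  [/\ free_complement (@Level r std' (fun v => v *m D = 0)),
      forall h, D h 0 \is 2.-homog,
      forall v, N1 v <-> exists w, v = w *m D
    & forall (Hm : pred nat) v, supp_in (fun _ m => Hm (mdeg m)) v ->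
      exists w, [/\ supp_in std1 w, supp_in (fun _ m => Hm (mdeg m)) w
                  & N1 (v - w)]].
Proof.
pose H : finType := {p : 'I_V * 'I_V | [&& isz p.1, isz p.2 & p.1 <= p.2]%N}.
pose a (h : 'I_#|H|) := (val (enum_val h)).1.
pose b (h : 'I_#|H|) := (val (enum_val h)).2.
have za h : isz (a h) by case/and3P: (valP (enum_val h)).
have zb h : isz (b h) by case/and3P: (valP (enum_val h)).
have le_ab h : (a h <= b h)%N by case/and3P: (valP (enum_val h)).
pose gi (h : 'I_#|H|) : 'I_1 := 0.
pose l h : mnm := (U_(a h) + U_(b h))%MM.
pose std' h := zbounded isz (b h) : pred mnm.
have [s0 s0_prop] := choice (fun h => I_quad (za h) (zb h)).
pose s h : 'rV[S]_1 := (s0 h)%:M.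
have sE h g : s h 0 g = s0 h by rewrite mxE (ord1 g).
have s_std h : supp_in std1 (s h).
  by move=> g m; rewrite sE; case: (s0_prop h) => _ + _; apply.
have s_deg h : supp_in (fun _ m => mdeg m == 2%N) (s h).
  by move=> g m; rewrite sE; case: (s0_prop h) => /dhomogP + _ _ => H2 /H2 ->.
have l_deg h : mdeg (l h) = 2%N by rewrite mdegD !mdeg1.
have N_gen h : N1 (lead_minus_tail gi l s h).
  rewrite /N1 !mxE eqxx mulr1 mpolyXD.
  by case: (s0_prop h).
have N_sub : submodule N1.
  split=> [|c u v]; first by rewrite /N1 mxE; case: I_closed.
  by rewrite /N1 !mxE; apply: I_closed.2.
have N_std0 v : N1 v -> supp_in std1 v -> v = 0.
  move=> Nv v_std; apply/rowP=> i; rewrite (ord1 i) [RHS]mxE.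
  by apply: I_std0 => // m /v_std.
have lead_cover g m : ~~ std1 g m ->
    exists h m', [/\ gi h = g, m = (l h + m')%MM & std' h m'].
  rewrite /std1 -ltnNge => m_gt1.
  have [v0 zv0 mv0] := zdeg_gt0 (ltnW m_gt1).
  have [v [zv mv _ v_min]] := zbounded_min zv0 mv0.
  have [m1 def_m] := mnm_split mv.
  have [u0 zu0 mu0] : exists2 u, isz u & m1 u != 0%N.
    by apply: zdeg_gt0; move: m_gt1; rewrite def_m zdegD zdeg1 zv.
  have [u [zu mu _ u_min]] := zbounded_min zu0 mu0.
  have [m2 def_m1] := mnm_split mu.
  have Huv : [&& isz v, isz u & v <= u]%N.
    rewrite zv zu; move/zboundedP: v_min; apply=> //.
    by rewrite def_m mnmDE; lia.
  exists (enum_rank (exist _ (v, u) Huv : H)), m2.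
  rewrite /l /std' /a /b enum_rankK /=; split; first by rewrite /gi [g]ord1.
    by rewrite def_m def_m1 addmA.
  by apply: zbounded_subm (U_(u)%MM) _ _; rewrite -def_m1.
have std'_a h m : std' h m -> zbounded isz (a h) (U_(b h) + m)%MM.
  move=> /zboundedP hm; apply/zboundedP=> v zv; rewrite mnmDE mnm1E.
  case: (b h =P v) => [<- _|_ /= mv]; first exact: le_ab.
  by apply: leq_trans (le_ab h) _; apply: hm.
have lead_uniq h h2 m m2 : std' h m -> std' h2 m2 ->
    gi h = gi h2 -> (l h + m = l h2 + m2)%MM -> h = h2.
  move=> hm hm2 _; rewrite /l -!addmA => eqm.
  have eq_a := zbounded_lead_uniq (za h) (za h2) (std'_a _ _ hm) (std'_a _ _ hm2) eqm.
  move: eqm; rewrite eq_a => /addmI /(zbounded_lead_uniq (zb h) (zb h2) hm hm2).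
  move=> eq_b; apply/enum_val_inj/val_inj.
  move: eq_a eq_b; rewrite /a /b.
  by case: (val (enum_val h)) (val (enum_val h2)) => [? ?] [? ?] /= -> ->.
have lead_nstd h m : std' h m -> ~~ std1 (gi h) (l h + m)%MM.
  by move=> _; rewrite /std1 !zdegD !zdeg1 za zb -ltnNge; lia.
have tail_dec h m g m' : std' h m -> m' \in msupp (s h 0 g) ->
    std1 g (m + m')%MM \/
    (zweight isz (m + m')%MM < zweight isz (l h + m)%MM)%N.
  (* Two z-variables of index below V weigh more than V.*2 together, and a tail of z-degree at most
     1 weighs at most V.*2. *)
  move=> _ /s_std le1; right.
  rewrite !zweightD !zweight1 za zb addnC ltn_add2r.
  apply: leq_ltn_trans (zweight_le _ _) _.
  have := ltn_ord (a h); have := ltn_ord (b h); move: le1; rewrite /std1.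
  by case: (zdeg isz m') => [|[|?]] //; lia.
exists #|H|, gi, l, (fun h => nat_of_ord (b h)), s; split=> //.
- split=> [|v vD v_std|h m].
  + split=> [|c u v uD vD]; first by rewrite /= mul0mx.
    by rewrite /= mulmxDl -scalemxAl uD vD scaler0 addr0.
  + exact: (step_mx_inj lead_uniq lead_nstd tail_dec) vD.
  + exact: (step_mx_ker_decomp N_sub N_std0 s_deg l_deg N_gen lead_cover tail_dec).
- by move=> h; apply: step_mx_homog.
- exact: (step_mx_image N_sub N_std0 s_deg l_deg N_gen lead_cover tail_dec).
- move=> Hm v v_deg; have [n vn] := supp_in_bound std1 (zweight isz) v.
  have [w [_ w_deg vw]] := step_reduce s_deg l_deg lead_cover tail_dec vn v_deg.
  exists (v - w *m step_mx gi l s); split=> //.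
    by apply: supp_inB => //; apply: step_mx_deg.
  by rewrite opprB addrC subrK; apply: step_mx_sub.
Qed.

Lemma normal_form (Hm : pred nat) (p : S) :
  {in msupp p, forall m, Hm (mdeg m)} ->
  exists s : S, [/\ {in msupp s, forall m, zdeg isz m <= 1}%N,
    {in msupp s, forall m, Hm (mdeg m)} & p - s \in I].
Proof.
have [r [gi [l [std' [s [_ _ _ red]]]]]] := base_level.
move=> p_deg; have [|w [w_std w_deg pw]] := red Hm p%:M.
  by move=> g m; rewrite mxE (ord1 g) => /p_deg.
exists (w 0 0); split=> [m /w_std|m /w_deg|] //.
by move: pw; rewrite /N1 !mxE.
Qed.

Theorem linear_resolution_of_quadratic_complement : linear_resolution 2 I.
Proof.
have [r [gi [l [std' [s]]]]] := base_level; set D0 := step_mx gi l s.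
case; set L0 := Level _ _ => good0 D0_homog D0_image _.
pose good := {L | free_complement L}.
have next (L : good) : exists LD : {L' : good & 'M[S]_(lrank (sval L'), lrank (sval L))},
  let L' := tag LD in let D := tagged LD in
  [/\ forall h g, D h g \is 1.-homog,
      forall v, @lsub (sval L) v <-> exists w, v = w *m D
    & forall v, @lsub (sval L') v <-> v *m D = 0].
  have [L' [D [goodL' D_homog D_image D_ker]]] := next_level (svalP L).
  by exists (existT _ (exist _ L' goodL') D).
pose step L := projT1 (cid (next L)).
have step_prop L := projT2 (cid (next L)); rewrite -/(step _) in step_prop.
pose lev i := iter i (fun L => tag (step L)) (exist _ L0 good0 : good).
pose F := @FreeComplex K V (fun i => lrank (sval (lev i))) (fun i _ => i + 2)%N
  D0 (fun i => tagged (step (lev i))).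
have lev_sub i (v : 'rV_(lrank (sval (lev i)))) :
    lsub v <-> exists w, v = w *m res_diff F i.
  by case: (step_prop (lev i)).
exists F; split=> //; split.
- split=> [k|i k h]; first exact: D0_homog.
  rewrite /homog_of_deg_diff /= leq_add2r leqnSn addSn subSnn.
  by case: (step_prop (lev i)).
- split=> [p|v|i v]; last 2 first.
  + exact: (lev_sub 0%N).
  + rewrite -(lev_sub i.+1); case: (step_prop (lev i)) => _ _ D_ker.
    by split=> /D_ker.
  + split=> [Ip|[v ->]]; last by apply/(D0_image (v *m D0)); exists v.
    have /D0_image[w def_p] : N1 p%:M by rewrite /N1 mxE.
    by exists w; rewrite -def_p mxE.
- move=> i k h; case: (step_prop (lev i)) => D_homog _ _.
  by apply: dhomog_nemf_coeff (D_homog k h) _; rewrite mf0.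
Qed.

End LinearSyzygies.

(** * Cohen-Macaulay quotients *)

Section Supports.
Variables (K : fieldType) (V : nat).
Local Notation S := {mpoly K[V]}.
Local Notation mnm := 'X_{1..V}.
Implicit Types (P Q : pred mnm) (p q : S) (v : 'I_V) (h : {poly K}).

Definition supp P p := forall m, m \in msupp p -> P m.

Lemma supp0 P : supp P 0.
Proof. by move=> m; rewrite msupp0. Qed.

Lemma suppD P p q : supp P p -> supp P q -> supp P (p + q).
Proof. by move=> Pp Pq m /msuppD_le; rewrite mem_cat => /orP[/Pp|/Pq]. Qed.

Lemma suppN P p : supp P p -> supp P (- p).
Proof. by move=> Pp m; rewrite (perm_mem (msuppN _)) => /Pp. Qed.

Lemma suppB P p q : supp P p -> supp P q -> supp P (p - q).
Proof. by move=> Pp Pq; apply: suppD => //; apply: suppN. Qed.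

Lemma supp_sum P (J : Type) (r : seq J) (F : J -> S) :
  (forall j, supp P (F j)) -> supp P (\sum_(j <- r) F j).
Proof. by move=> PF; apply: big_ind => //; [exact: supp0 | exact: suppD]. Qed.

Lemma suppZ P c p : supp P p -> supp P (c *: p).
Proof. by move=> Pp m /msuppZ_le /Pp. Qed.

Lemma suppX P m : P m -> supp P 'X_[m].
Proof. by move=> Pm m' /mem_msuppXP <-. Qed.

Lemma suppM P Q Q' p q : (forall m m', P m -> Q m' -> Q' (m + m')%MM) ->
  supp P p -> supp Q q -> supp Q' (p * q).
Proof.
by move=> PQ Pp Qq m /msuppM_le /allpairsP[[m1 m2]] /= [/Pp ? /Qq ? ->]; apply: PQ.
Qed.

Lemma supp_ind P (Q : S -> Prop) :
    Q 0 -> (forall p q, Q p -> Q q -> Q (p + q)) ->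
    (forall c m, P m -> Q (c *: 'X_[m])) ->
  forall p, supp P p -> Q p.
Proof.
move=> Q0 QD QX p Pp; rewrite [p]mpolyE big_seq.
by apply: big_ind => // m /Pp; apply: QX.
Qed.

Definition at_var v h : S := (map_poly (@mpolyC V K) h).['X_v].

Lemma at_varE v h : at_var v h = \sum_(i < size h) h`_i *: 'X_[U_(v) *+ i].
Proof.
rewrite /at_var (@horner_coef_wide _ (size h)) ?size_poly //.
by apply: eq_bigr => i _; rewrite coef_map /= mul_mpolyC mpolyXn.
Qed.

Lemma at_varD v h1 h2 : at_var v (h1 + h2) = at_var v h1 + at_var v h2.
Proof. by rewrite /at_var rmorphD hornerD. Qed.

Lemma at_varM v h1 h2 : at_var v (h1 * h2) = at_var v h1 * at_var v h2.
Proof. by rewrite /at_var rmorphM hornerM. Qed.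

Lemma at_varXn v i : at_var v 'X^i = 'X_[U_(v) *+ i].
Proof. by rewrite /at_var map_polyXn hornerXn mpolyXn. Qed.

Lemma suppM_at_var P Q v h p :
    (forall m i, (i < size h)%N -> P m -> Q (m + U_(v) *+ i)%MM) ->
  supp P p -> supp Q (p * at_var v h).
Proof.
move=> PQ Pp; rewrite at_varE mulr_sumr; apply: supp_sum => i.
apply: (@suppM P (pred1 (U_(v) *+ i)%MM)) => // [m m' Pm /eqP ->|].
  exact: PQ.
by apply: suppZ; apply: suppX => /=.
Qed.

(* The exponents of v in p shift by deg h in p * h(X_v), as h is monic. *)
Lemma mul_at_var_eq0 v h p : h \is monic ->
  supp (fun m => m v < (size h).-1)%N (p * at_var v h) -> p = 0.
Proof.
move=> h_monic red; apply: contrapT => /eqP p_neq0.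
have [m0 pm0 m0_max] : exists2 m0, m0 \in msupp p &
    forall m, m \in msupp p -> (m v <= m0 v)%N.
  have exP : exists n, has (fun m : mnm => m v == n) (msupp p).
    by exists (mlead p v); apply/hasP; exists (mlead p); rewrite ?mlead_supp.
  have leP n : has (fun m : mnm => m v == n) (msupp p) -> (n <= \max_(m <- msupp p) m v)%N.
    by case/hasP=> m pm /eqP <-; rewrite (big_rem m) //= leq_maxl.
  case: (ex_maxnP exP leP) => n /hasP[m0 pm0 /eqP <-] n_max.
  by exists m0 => // m pm; apply: n_max; apply/hasP; exists m.
set e := (size h).-1 in red.
have sz_h : size h = e.+1 by rewrite prednK // size_poly_gt0 monic_neq0.
have coef_m0 : (p * at_var v h)@_(U_(v) *+ e + m0)%MM = p@_m0.
  rewrite at_varE mulr_sumr raddf_sum /= sz_h big_ord_recr /= big1 => [|i _].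
    rewrite add0r -scalerAr mcoeffZ mcoeffMX.
    by have := monicP h_monic; rewrite lead_coefE -/e => ->; rewrite mul1r.
  rewrite -scalerAr mcoeffZ.
  have -> : (U_(v) *+ e + m0 = U_(v) *+ i + (U_(v) *+ (e - i) + m0))%MM.
    apply/mnmP=> u; rewrite !mnmDE !mulmnE addnA -mulnDr subnKC //.
    exact: ltnW.
  rewrite mcoeffMX memN_msupp_eq0 ?mulr0 //; apply/negP=> /m0_max.
  rewrite mnmDE mulmnE mnm1E eqxx mul1n; have := ltn_ord i; lia.
have /red : (U_(v) *+ e + m0)%MM \in msupp (p * at_var v h).
  by rewrite mcoeff_msupp coef_m0 -mcoeff_msupp.
by rewrite mnmDE mulmnE mnm1E eqxx mul1n; lia.
Qed.

Lemma mnm_split_var (m : mnm) v : exists2 m' : mnm, m' v = 0%N & m = (m' + U_(v) *+ m v)%MM.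
Proof.
exists (m - U_(v) *+ m v)%MM.
  by rewrite mnmBE mulmnE mnm1E eqxx mul1n subnn.
apply/mnmP=> u; rewrite mnmDE mnmBE mulmnE mnm1E.
by case: eqP => [<-|_]; rewrite ?mul1n ?mul0n ?subnn ?subn0 ?addn0.
Qed.

(** Division takes place in K[t], on the power of X_v in each monomial; [P] ignores the exponent of
    v, so it passes to quotient and remainder. *)
Lemma div_at_var v h P p :
    h \is monic -> (forall m i j, P (m + U_(v) *+ i)%MM -> P (m + U_(v) *+ j)%MM) ->
    supp P p ->
  exists q r, [/\ supp P q, supp P r, supp (fun m => m v < (size h).-1)%N r
                & p = q * at_var v h + r].
Proof.
move=> h_monic P_v; move: p; apply: supp_ind.
- by exists 0, 0; split; rewrite ?mul0r ?addr0 //; apply: supp0.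
- move=> p p' [q [r [Pq Pr rr ->]]] [q' [r' [Pq' Pr' rr' ->]]].
  exists (q + q'), (r + r'); split; try exact: suppD.
  by rewrite mulrDl addrACA.
- move=> c m Pm; have [m' m'v def_m] := mnm_split_var m v.
  have Pm' i : P (m' + U_(v) *+ i)%MM by apply: (P_v m' (m v)); rewrite -def_m.
  pose k : {poly K} := 'X^(m v).
  exists (c *: 'X_[m'] * at_var v (k %/ h)), (c *: 'X_[m'] * at_var v (k %% h)).
  have sz_h : (0 < size h)%N by rewrite size_poly_gt0 monic_neq0.
  split.
  + apply: (@suppM_at_var (pred1 m')); first by move=> m2 i _ /eqP ->.
    by apply: suppZ; apply: suppX => /=.
  + apply: (@suppM_at_var (pred1 m')); first by move=> m2 i _ /eqP ->.
    by apply: suppZ; apply: suppX => /=.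
  + apply: (@suppM_at_var (pred1 m')); last by apply: suppZ; apply: suppX => /=.
    move=> m2 i lt_i /eqP ->; rewrite mnmDE mulmnE mnm1E eqxx mul1n m'v add0n.
    by apply: leq_trans lt_i _; rewrite -ltnS prednK // ltn_modp monic_neq0.
  + rewrite -mulrA -mulrDr -at_varM -at_varD -divp_eq at_varXn.
    by rewrite -scalerAl -mpolyXD -def_m.
Qed.

End Supports.

(** * Quotients that are free over the P-variables *)

Section QuotientCM.
Variables (K : fieldType) (V : nat) (isz : pred 'I_V).
Local Notation S := {mpoly K[V]}.
Local Notation mnm := 'X_{1..V}.
Variable I : {pred S}.
Hypothesis I_closed : lin_closed I.
Hypothesis I_quad : forall a b, isz a -> isz b -> exists s : S,
  [/\ s \is 2.-homog, {in msupp s, forall m, zdeg isz m <= 1}%N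
    & 'X_a * 'X_b - s \in I].
Hypothesis I_std0 : forall p : S, p \in I ->
  {in msupp p, forall m, zdeg isz m <= 1}%N -> p = 0.
Variables (R : comNzRingType) (rho : {rmorphism S -> R}).
Hypothesis rho_surj : forall y, exists p, rho p = y.
Hypothesis rho_ker : forall p, (rho p == 0) = (p \in I).

Let zstd : pred mnm := fun m => (zdeg isz m <= 1)%N.
Let d := #|[pred v | ~~ isz v]|.
Let iota : {rmorphism K -> R} := rho \o @mpolyC V K.

Lemma rho_eq p q : p - q \in I -> rho p = rho q.
Proof. by rewrite -rho_ker rmorphB subr_eq0 => /eqP. Qed.

Lemma zdeg_var m v i : ~~ isz v -> zdeg isz (m + U_(v) *+ i)%MM = zdeg isz m.
Proof.
move=> zv; rewrite zdegD [X in (_ + X)%N]big1 ?addn0 // => u zu.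
rewrite mulmnE mnm1E; case: eqP zu => [<-|_]; first by rewrite (negPf zv).
by rewrite mul0n.
Qed.

Lemma normal_form_deg D (p : S) : supp (fun m => mdeg m <= D)%N p ->
  exists s, [/\ supp zstd s, supp (fun m => mdeg m <= D)%N s & p - s \in I].
Proof.
exact: (@normal_form K V isz I I_closed I_quad I_std0 (fun e => e <= D)%N).
Qed.

Lemma normal_formE (p : S) : exists2 s, supp zstd s & p - s \in I.
Proof.
have [|s [s_std _ ps]] := @normal_form_deg (msize p) p; last by exists s.
by move=> m /msize_mdeg_lt /ltnW.
Qed.

(** Write each coefficient as c_j = q_j G_v + r_j with r_j of degree below deg g_v in X_v. Then (a -
    sum q_j G_(u_j)) G_v = sum r_j G_(u_j), where a nonzero multiple of G_v would have larger degree
    in X_v; hence a = sum q_j G_(u_j). *)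
Lemma regular_at_var (g : 'I_V -> {poly K}) (vs : seq 'I_V) v a :
    (forall u, g u \is monic) -> all (fun u => ~~ isz u) vs -> ~~ isz v ->
    v \notin vs ->
    a * rho (at_var v (g v)) \in ideal_gen [seq rho (at_var u (g u)) | u <- vs] ->
  a \in ideal_gen [seq rho (at_var u (g u)) | u <- vs].
Proof.
move=> g_monic zvs zv vs_v; pose G u := at_var u (g u); rewrite -/(G v).
set gens := [seq _ | u <- vs]; have [A <-] := rho_surj a.
have sz_gens : size gens = size vs by rewrite size_map.
have vs_nth (j : 'I_(size gens)) : nth v vs j \in vs by rewrite mem_nth // -sz_gens.
have zu (j : 'I_(size gens)) : ~~ isz (nth v vs j) by apply: (allP zvs).
have gensE (j : 'I_(size gens)) : gens`_j = rho (G (nth v vs j)).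
  by rewrite (nth_map v) // -sz_gens.
case/asboolP=> c; rewrite -rmorphM => sum_c.
have [C CP] := choice (fun j => rho_surj (c j)).
have reduce (j : 'I_(size gens)) : exists qr : S * S,
    [/\ supp zstd qr.2, supp (fun m => m v < (size (g v)).-1)%N qr.2
      & c j = rho (qr.1 * G v + qr.2)].
  have [s s_std Cs] := normal_formE (C j).
  have [|q [r [_ r_std r_red def_s]]] := @div_at_var _ _ v (g v) zstd s (g_monic v) _ s_std.
    by move=> m i k; rewrite /zstd !zdeg_var.
  by exists (q, r); split=> //=; rewrite -def_s -(rho_eq Cs) CP.
have [qr qrP] := choice reduce.
pose B := A - \sum_j (qr j).1 * G (nth v vs j).
have [B' B'_std BB'] := normal_formE B.
pose r := \sum_j (qr j).2 * G (nth v vs j).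
have shift_zstd u (p : S) : ~~ isz u -> supp zstd p -> supp zstd (p * G u).
  by move=> zu'; apply: suppM_at_var => m i _; rewrite /zstd zdeg_var.
have BG : rho (B * G v) = rho r.
  rewrite /B mulrBl rmorphB sum_c /r mulr_suml !rmorph_sum -sumrB.
  apply: eq_bigr => j _; have [_ _ ->] := qrP j.
  by rewrite gensE -rmorphM -rmorphB; congr (rho _); ring.
(* Both sides are standard, as P-variables do not change the z-degree. So the congruence modulo I is
   an equality in S, where degrees in X_v can be compared. *)
have B'G : B' * G v = r.
  apply/eqP; rewrite -subr_eq0; apply/eqP; apply: I_std0; last first.
    apply: suppB; first exact: shift_zstd.
    by apply: supp_sum => j; apply: shift_zstd => //; case: (qrP j).
  by rewrite -rho_ker rmorphB rmorphM -(rho_eq BB') -rmorphM BG subrr.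
have B'0 : B' = 0.
  apply: (@mul_at_var_eq0 _ _ v _ _ (g_monic v)); rewrite -/(G v) B'G.
  apply: supp_sum => j; have [_ r_red _] := qrP j.
  apply: suppM_at_var r_red => m i _; rewrite mnmDE mulmnE mnm1E.
  have /negPf -> : nth v vs j != v by apply: contraNneq vs_v => E; rewrite -E; apply: vs_nth.
  by rewrite mul0n addn0.
have : rho B = 0 by rewrite (rho_eq BB') B'0 rmorph0.
rewrite /B rmorphB => /eqP; rewrite subr_eq0 => /eqP ->.
rewrite rmorph_sum; apply: (lin_sum _ (ideal_gen_lin _)) => j _.
by rewrite rmorphM -gensE; apply: (linM (ideal_gen_lin _)); apply: ideal_gen_nth.
Qed.

Lemma residue_algebraic (M : {pred R}) v : maximal_ideal M ->
  exists g : {poly K}, g \is monic /\ rho (at_var v g) \in M.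
Proof.
move=> M_max; have [L [pi [pi_surj pi_eq0]]] := residue_field M_max.
pose iotaL : {rmorphism K -> L} := pi \o (rho \o @mpolyC V K).
pose xs := [seq pi (rho 'X_u) | u <- enum 'I_V].
have gen y : generated iotaL xs y.
  have [z <-] := pi_surj y; have [p <-] := rho_surj z.
  have genX m : generated iotaL xs (pi (rho 'X_[m])).
    have gen1 : generated iotaL xs 1 by rewrite -(rmorph1 iotaL); apply: Gen_const.
    rewrite mpolyXE_id !rmorph_prod; apply: big_ind => // [x x'|u _].
      exact: Gen_mul.
    rewrite !rmorphXn; elim: (m u) => [|k IHk]; first by rewrite expr0.
    rewrite exprS; apply: Gen_mul => //; apply: Gen_var.
    by apply: map_f; rewrite mem_enum.
  apply: (@supp_ind K V predT (fun p => generated iotaL xs (pi (rho p)))) => //.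
  - by rewrite !rmorph0 -(rmorph0 iotaL); apply: Gen_const.
  - by move=> q q' Hq Hq'; rewrite !rmorphD; apply: Gen_add.
  - move=> c m _; rewrite -mul_mpolyC !rmorphM; apply: Gen_mul => //.
    exact: (Gen_const iotaL xs c).
have : algebraicOver iotaL (pi (rho 'X_v)).
  by apply: (zariski (erefl (size xs)) gen); apply: map_f; rewrite mem_enum.
case/integral_algebraic=> g g_monic /rootP g0; exists g; split=> //.
rewrite -pi_eq0 /at_var -!horner_map /= -!map_poly_comp; apply/eqP.
by rewrite -[RHS]g0; congr horner; apply: eq_map_poly.
Qed.

Lemma residue_regular_sequence (M : {pred R}) : maximal_ideal M ->
  exists s, [/\ size s = d, {subset s <= M} & weakly_regular s].
Proof.
move=> M_max; have [g gP] := choice (fun v => residue_algebraic v M_max).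
pose vs := enum [pred v | ~~ isz v].
exists [seq rho (at_var v (g v)) | v <- vs]; split.
- by rewrite size_map /d cardE.
- by move=> _ /mapP[v _ ->]; case: (gP v).
- move=> i a; rewrite size_map => lt_i.
  have v0 : 'I_V by case: vs lt_i => // v.
  rewrite -map_take (nth_map v0) //; apply: regular_at_var.
  + by move=> u; case: (gP u).
  + by apply/allP=> u /mem_take; rewrite mem_enum.
  + by have := mem_nth v0 lt_i; rewrite mem_enum.
  + have := enum_uniq [pred v | ~~ isz v]; rewrite -/vs => uniq_vs.
    have : uniq (take i vs ++ drop i vs) by rewrite cat_take_drop.
    rewrite (drop_nth v0) // cat_uniq => /and3P[_ + _].
    by rewrite /= negb_or => /andP[].
Qed.

(** An overcount of the standard monomials of degree at most D: the z-variable, if any, and the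
    exponents of the P-variables. A P-variable in the first component counts as no z-variable. *)
Definition bounded_index D : finType :=
  (option 'I_V * {ffun {v : 'I_V | ~~ isz v} -> 'I_D.+1})%type.

Definition bounded_mnm D (t : bounded_index D) : mnm :=
  [multinom if insub v is Some u then nat_of_ord (t.2 u) else (t.1 == Some v) : nat
    | v < V].

Lemma card_bounded_index D : #|bounded_index D| = (V.+1 * D.+1 ^ d)%N.
Proof. by rewrite card_prod card_option card_ord card_ffun card_ord card_sig. Qed.

Lemma bounded_mnm_surj D m : zstd m -> (mdeg m <= D)%N ->
  exists t : bounded_index D, bounded_mnm t = m.
Proof.
rewrite /zstd => m_std m_deg.
have m_le v : (m v <= D)%N.
  by apply: leq_trans m_deg; rewrite mdegE (bigD1 v) //= leq_addr.
exists ([pick v | isz v && (m v != 0%N)], [ffun u => inord (m (val u))]).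
apply/mnmP=> v; rewrite mnmE; case: insubP => [u zv def_u|].
  by rewrite ffunE inordK ?ltnS // def_u.
rewrite negbK /= => zv; case: pickP => [u /andP[zu mu]|no_u]; last first.
  by apply/esym/eqP; have := no_u v; rewrite zv /= => /negPn.
have [<-|neq_uv] := eqVneq u v.
  rewrite eqxx; move: m_std; rewrite /zdeg (bigD1 u) //=; move: mu.
  by case: (m u) => [|[|k]].
rewrite (negPf (_ : Some u != Some v)) //; move: m_std.
by rewrite /zdeg (bigD1 u) //= (bigD1 v) /=; [lia | rewrite zv eq_sym].
Qed.

Lemma supp_monomial k c (p : nat -> S) j (a : exponents k j) :
  (forall i, (i < j)%N -> supp (fun m => mdeg m <= c)%N (p i)) ->
  supp (fun m => mdeg m <= j * (k * c))%N (monomial p a).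
Proof.
elim: j p a => [|j IHj] p a Hp /=; first by move=> m; rewrite msupp1 inE => /eqP ->; rewrite mdeg0.
apply: (@suppM _ _ (fun m => mdeg m <= k * c)%N (fun m => mdeg m <= j * (k * c))%N).
- by move=> m m' Hm Hm'; rewrite mdegD mulSn leq_add.
- have Hpow e : supp (fun m => mdeg m <= e * c)%N (p 0%N ^+ e).
    elim: e => [|e IHe]; first by move=> m; rewrite expr0 msupp1 inE => /eqP ->; rewrite mdeg0.
    rewrite exprS; apply: suppM (Hp 0%N isT) IHe => m m' Hm Hm'.
    by rewrite mdegD mulSn leq_add.
  move=> m /Hpow; move=> /leq_trans; apply.
  by rewrite leq_mul2r ltnW ?orbT.
- by apply: IHj => i lt_ij; apply: Hp.
Qed.

(** The k^(d+1) monomials in x_0, ..., x_d have normal forms of degree at most D, which is linear in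
    k, while the standard monomials of such degree number O(k^d). For large k the normal forms are
    linearly dependent over K. *)
Lemma algebraic_dependence (x : nat -> R) : exists k (c : exponents k d.+1 -> K),
  (exists a, c a != 0) /\ \sum_a iota (c a) * monomial x a = 0.
Proof.
have [p px] := choice (fun i => rho_surj (x i)).
pose c0 := (\max_(i < d.+1) msize (p i))%N.
have p_deg i : (i < d.+1)%N -> supp (fun m => mdeg m <= c0)%N (p i).
  move=> lt_i m /msize_mdeg_lt /ltnW /leq_trans; apply.
  exact: (leq_bigmax (Ordinal lt_i)).
(* As D + 1 <= k ((d+1) c0 + 1), this k exceeds the constant in front of k^d. *)
pose k := (V.+1 * (d.+1 * c0).+1 ^ d).+1.
pose D := (d.+1 * (k * c0))%N.
have few : (V.+1 * D.+1 ^ d < k ^ d.+1)%N.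
  apply: (@leq_ltn_trans (V.+1 * (k * (d.+1 * c0).+1) ^ d)%N).
    have leq_exp a b e : (a <= b -> a ^ e <= b ^ e)%N.
      by case: e => // e le_ab; rewrite leq_exp2r.
    by rewrite leq_mul2l /=; apply: leq_exp; rewrite /D mulnS mulnCA addnC -addn1 leq_add.
  by rewrite expnMn mulnCA expnS mulnC ltn_mul2r expn_gt0 /=.
have [NF NFP] := choice (fun a => normal_form_deg (@supp_monomial k c0 p d.+1 a p_deg)).
pose rows := #|exponents k d.+1|; pose cols := #|bounded_index D|.
pose A : 'M[K]_(rows, cols) :=
  \matrix_(i, j) (NF (enum_val i))@_(bounded_mnm (enum_val j)).
have ker_neq0 : kermx A != 0.
  rewrite -mxrank_eq0 mxrank_ker subn_eq0 -ltnNge.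
  apply: leq_ltn_trans (rank_leq_col A) _.
  by rewrite /cols card_bounded_index /rows card_exponents.
pose u := nz_row (kermx A); have u_neq0 : u != 0 by rewrite nz_row_eq0.
have uA0 : u *m A = 0 by apply/sub_kermxP; apply: nz_row_sub.
exists k, (fun a => u 0 (enum_rank a)); split.
  have /existsP[i ui] : [exists i, u 0 i != 0].
    apply: contraNT u_neq0; rewrite negb_exists => /forallP u0.
    by apply/eqP/rowP=> i; rewrite mxE; apply/eqP; rewrite -[_ == _]negbK u0.
  by exists (enum_val i); rewrite enum_valK.
have sumNF : \sum_a u 0 (enum_rank a) *: NF a = 0.
  apply/mpolyP=> m; rewrite mcoeff0 raddf_sum /=.
  have [/andP[m_std m_deg]|m_out] := boolP (zstd m && (mdeg m <= D)%N).
    have [t <-] := bounded_mnm_surj m_std m_deg.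
    transitivity ((u *m A) 0 (enum_rank t)); last by rewrite uA0 mxE.
    rewrite mxE.
    rewrite (reindex_onto (@enum_val _ (exponents k d.+1)) enum_rank) /=; last first.
      by move=> a _; rewrite enum_rankK.
    by apply: eq_big => [i|i _]; rewrite enum_valK ?eqxx // mcoeffZ !mxE enum_rankK.
  rewrite big1 // => a _; rewrite mcoeffZ memN_msupp_eq0 ?mulr0 //.
  case: (NFP a) => NF_std NF_deg _; apply: contra m_out => NFm.
  by rewrite NF_std ?NF_deg.
transitivity (rho (\sum_a u 0 (enum_rank a) *: NF a)); last by rewrite sumNF rmorph0.
rewrite rmorph_sum; apply: eq_bigr => a _; rewrite -mul_mpolyC rmorphM; congr (_ * _).
case: (NFP a) => _ _ /rho_eq <-; rewrite monomial_rmorph.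
by congr (monomial _ a); apply/funext => i /=; rewrite px.
Qed.

Theorem quadratic_complement_cm : cohen_macaulay R.
Proof.
apply: (cm_criterion _ algebraic_dependence residue_regular_sequence).
exact: noetherian_surj rho_surj (hilbert_basis (V:=V)).
Qed.

End QuotientCM.

(** * The ideal of 2-minors *)

Section GradedEndomorphism.
Variables (K : fieldType) (V : nat).
Local Notation S := {mpoly K[V]}.

Lemma rmorph_mpoly_ext (R : nzRingType) (f g : {rmorphism S -> R}) :
  (forall c, f c%:MP = g c%:MP) -> (forall v, f 'X_v = g 'X_v) -> f =1 g.
Proof.
move=> eq_c eq_v; apply: mpolyind => [|c m p _ _ IHp]; first by rewrite !rmorph0.
rewrite !rmorphD IHp -mul_mpolyC !rmorphM eq_c mpolyXE_id !rmorph_prod.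
by congr (_ * _ + _); apply: eq_bigr => v _; rewrite !rmorphXn eq_v.
Qed.

Variable h : 'I_V -> S.
Hypothesis h_homog : forall v, h v \is 1.-homog.

Definition linear_subst : {rmorphism S -> S} := mmap (@mpolyC V K) h.

Lemma linear_substC c : linear_subst c%:MP = c%:MP.
Proof. exact: mmapC. Qed.

Lemma linear_substX v : linear_subst 'X_v = h v.
Proof. by rewrite /linear_subst /= mmapX mmap1U. Qed.

Lemma linear_subst_homog d p : p \is d.-homog -> linear_subst p \is d.-homog.
Proof.
move=> /dhomogP p_homog; rewrite [p]mpolyE big_seq rmorph_sum; apply: rpred_sum.
move=> m /p_homog <-; rewrite -mul_mpolyC rmorphM linear_substC mul_mpolyC.
apply: rpredZ; rewrite mpolyXE_id rmorph_prod /=.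
have -> : mdeg m = (\sum_v m v)%N by rewrite mdegE.
apply: (big_ind2 (fun (q : S) d => q \is d.-homog)) => [|q1 d1 q2 d2|v _].
- exact: dhomog1.
- exact: dhomogM.
- rewrite rmorphXn linear_substX -[X in X.-homog]mul1n.
  exact: dhomogMn.
Qed.

Hypothesis subst_inv : involutive linear_subst.

(** A degree-preserving automorphism, applied to every matrix entry, carries the whole resolution
    along; being an involution, it is its own inverse in the exactness statements. *)
Lemma linear_resolution_subst q (I J : {pred S}) :
  (forall p, (p \in J) = (linear_subst p \in I)) ->
  linear_resolution q I -> linear_resolution q J.
Proof.
move=> JI [F [[[aug_homog diff_homog] [F_gen F0 Fi] _] F_deg]].
pose s := linear_subst.
have mapK m n : involutive (map_mx s : 'M[S]_(m, n) -> 'M[S]_(m, n)).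
  by move=> A; apply/matrixP=> i j; rewrite !mxE subst_inv.
have map_mul m n p (A : 'M[S]_(m, n)) (B : 'M[S]_(n, p)) C :
    C = A *m map_mx s B <-> map_mx s C = map_mx s A *m B.
  rewrite -{2}[B]mapK -map_mxM; split=> [->//|E].
  by apply: (can_inj (@mapK _ _)).
pose G := @FreeComplex K V (res_rank F) (@res_deg _ _ F) (map_mx s (res_aug F))
  (fun i => map_mx s (res_diff F i)).
have diff1 i k l : res_diff F i k l \is 1.-homog.
  have := diff_homog i k l; rewrite !F_deg /homog_of_deg_diff.
  by rewrite leq_add2r leqnSn subnDr subSnn.
have ker_iff a b c (A : 'M[S]_(a, b)) (B : 'M[S]_(c, a)) :
    (forall v : 'rV_a, v *m A = 0 <-> exists w, v = w *m B) ->
    forall v : 'rV_a, v *m map_mx s A = 0 <-> exists w, v = w *m map_mx s B.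
  move=> AB v; split=> [/esym/map_mul|[w /map_mul def_v]].
    rewrite map_mx0 => /esym/AB[w def_w]; exists (map_mx s w).
    by apply/map_mul; rewrite mapK.
  by apply/esym/map_mul; rewrite map_mx0; apply/esym/AB; exists (map_mx s w).
exists G; split=> //; split; [split|split|] => /=.
- by move=> k; rewrite mxE; apply: linear_subst_homog.
- move=> i k l; rewrite !F_deg /homog_of_deg_diff leq_add2r leqnSn subnDr subSnn.
  by rewrite mxE; apply: linear_subst_homog.
- move=> p; rewrite JI; split=> [/F_gen[v def_p]|[v def_p]]; last first.
    apply/F_gen; exists (map_mx s v).
    by rewrite def_p -[in RHS](mapK _ _ (res_aug F)) -map_mxM [RHS]mxE.
  exists (map_mx s v); rewrite -map_mxM mxE -def_p.
  by rewrite subst_inv.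
- exact: ker_iff.
- by move=> i; apply: ker_iff.
- move=> i k l; rewrite mxE.
  by apply: dhomog_nemf_coeff (linear_subst_homog (diff1 i k l)) _; rewrite mf0.
Qed.

End GradedEndomorphism.

(** * Straightening modulo the minors, and the parametrization *)

Section Scroll.
Variables (K : fieldType) (n' : nat).
Local Notation n := n'.+1.
Variable delta : {set 'I_n}.
Hypothesis delta_gt0 : forall i : 'I_n, i \in delta -> (0 < i)%N.

Local Notation V := #|vars delta|.
Local Notation S := {mpoly K[V]}.
Local Notation mnm := 'X_{1..V}.
Local Notation x := (xvar K delta).
Local Notation y := (@yvar K n delta).
Local Notation xi := (xi K delta).
Local Notation I := (minor_ideal K delta).

Definition xidx (i : 'I_n) : 'I_V := enum_rank (inl i : vars delta).
Definition yidx (j : {j : 'I_n | j \notin delta}) : 'I_V := enum_rank (inr j : vars delta).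

Lemma idxP (P : 'I_V -> Prop) :
  (forall i, P (xidx i)) -> (forall j, P (yidx j)) -> forall v, P v.
Proof.
move=> Px Py v; rewrite -[v]enum_valK.
by case: (enum_val v) => [i|j]; [apply: Px | apply: Py].
Qed.

Definition theta (i : 'I_n) : S := if insub i is Some j then y j else 0.

Definition sub_var (v : 'I_V) : S :=
  if enum_val v is inr j then
    if val j == 0 then y j else x (ord_pred (val j)) - y j
  else 'X_v.

Definition sub := linear_subst sub_var.

Lemma delta0 : ord0 \notin delta.
Proof. by apply/negP=> /delta_gt0. Qed.

Definition j0 : {j : 'I_n | j \notin delta} := exist _ ord0 delta0.

Lemma xi0 : xi ord0 = y j0.
Proof.
rewrite /Defs.xi insubT ?delta0 // => H; congr (yvar _ _); exact: val_inj.
Qed.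

Lemma sub_varx i : sub_var (xidx i) = x i.
Proof. by rewrite /sub_var enum_rankK. Qed.

Lemma sub_vary j : sub_var (yidx j) =
  if val j == 0 then y j else x (ord_pred (val j)) - y j.
Proof. by rewrite /sub_var enum_rankK. Qed.

Lemma sub_var_homog v : sub_var v \is 1.-homog.
Proof.
have homogX w : ('X_w : S) \is 1.-homog by rewrite dhomogX; apply/eqP/mdeg1.
elim/idxP: v => [i|j]; first by rewrite sub_varx; apply: homogX.
by rewrite sub_vary; case: ifP => _; rewrite ?rpredB // homogX.
Qed.

Lemma sub_x i : sub (x i) = x i.
Proof. by rewrite /sub linear_substX sub_varx. Qed.

Lemma sub_y j : sub (y j) = if val j == 0 then y j else x (ord_pred (val j)) - y j.
Proof. by rewrite /sub linear_substX sub_vary. Qed.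

Lemma sub_inv : involutive sub.
Proof.
move=> p; apply: (@rmorph_mpoly_ext _ _ _ (sub \o sub) idfun) => [c|v].
  by rewrite /= !linear_substC.
elim/idxP: v => [i|j] /=; first by rewrite -/(x i) !sub_x.
rewrite -/(y j) sub_y; case: ifP => j_eq0; first by rewrite sub_y j_eq0.
by rewrite rmorphB sub_x sub_y j_eq0 opprB addrC subrK.
Qed.

Lemma sub_theta (i : 'I_n) : (0 < i)%N -> sub (theta i) = x (ord_pred i) - xi i.
Proof.
rewrite /theta /Defs.xi => i_gt0; case: insubP => [j _ def_j|_].
  by rewrite sub_y def_j -val_eqE /= gtn_eqF.
by rewrite subrr rmorph0.
Qed.

Lemma minor_in (i j : 'I_n) : (i < j)%N -> x i * xi j - x j * xi i \in I.
Proof.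
move=> lt_ij; apply: ideal_gen_mem.
have -> : x i * xi j - x j * xi i = minor2 K delta i j by rewrite /minor2 !mxE.
by apply: (image_f (fun ij => minor2 K delta ij.1 ij.2) (x := (i, j))).
Qed.

Lemma I_lin : lin_closed I.
Proof. exact: ideal_gen_lin. Qed.

Definition isz : pred 'I_V := fun v => if enum_val v is inl i then (i.+1 < n)%N else false.

Lemma isz_x i : isz (xidx i) = (i.+1 < n)%N.
Proof. by rewrite /isz enum_rankK. Qed.

Lemma isz_y j : isz (yidx j) = false.
Proof. by rewrite /isz enum_rankK. Qed.

(** The ideal I read in the coordinates of [sub]: it is J, not I, that the standard monomials
    complement, and [sub_inv] leads back to I. *)
Let J : {pred S} := fun p => sub p \in I.

Lemma mem_J p : (p \in J) = (sub p \in I). Proof. by []. Qed.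

Lemma J_lin : lin_closed J.
Proof.
split; first by rewrite mem_J rmorph0; case: I_lin.
by move=> a u v; rewrite !mem_J rmorphD rmorphM; apply: I_lin.2.
Qed.

Let reduced (s : S) := s \is 2.-homog /\ supp (fun m => zdeg isz m <= 1)%N s.

Lemma theta_cases i : theta i = 0 \/ exists j, theta i = y j.
Proof. by rewrite /theta; case: insubP => [j _ _|_]; [right; exists j | left]. Qed.

Lemma reduced_var2 v w : (isz v + isz w <= 1)%N -> reduced ('X_v * 'X_w).
Proof.
rewrite /reduced -mpolyXD => le1; split.
  by rewrite dhomogX; apply/eqP/(etrans (mdegD _ _)); rewrite !mdeg1.
by apply: suppX; rewrite zdegD !zdeg1.
Qed.

Lemma reduced_xy i j : reduced (x i * y j).
Proof. by apply: reduced_var2; rewrite isz_y addn0 leq_b1. Qed.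

Lemma reduced_xtheta i j : reduced (x i * theta j).
Proof.
have [->|[k ->]] := theta_cases j; last exact: reduced_xy.
by rewrite mulr0; split; [rewrite rpred0 | exact: supp0].
Qed.

Lemma reducedB s t : reduced s -> reduced t -> reduced (s - t).
Proof. by case=> hs ss [ht st]; split; [exact: rpredB | exact: suppB]. Qed.

Lemma reducedD s t : reduced s -> reduced t -> reduced (s + t).
Proof. by case=> hs ss [ht st]; split; [exact: rpredD | exact: suppD]. Qed.

(* x_i x_k = x_(i-1) x_(k+1) + terms linear in z, modulo J. *)
Lemma quad_reduce (i k : 'I_n) : (i <= k)%N ->
  exists2 s, reduced s & x i * x k - sub s \in I.
Proof.
move: {-1}(nat_of_ord i) (erefl (nat_of_ord i)) => a.
elim: a i k => [|a IHa] i k def_a le_ik.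
all: have [eq_kn|neq_kn] := eqVneq k.+1 n.
(* In the last column x_k is a P-variable, so the product is already standard. *)
1,3: exists (x i * x k); last by rewrite rmorphM !sub_x subrr; case: I_lin.
1,2: by apply: reduced_var2; rewrite !isz_x eq_kn ltnn addn0 leq_b1.
all: have lt_kn : (k.+1 < n)%N by have := ltn_ord k; lia.
all: pose k1 := Ordinal lt_kn.
all: have pred_k1 : ord_pred k1 = k by apply: val_inj; rewrite /= modnDr modn_small.
all: have xk : x k = xi k1 + sub (theta k1) by rewrite sub_theta // pred_k1 addrC subrK.
all: have minor_ik : x i * xi k1 - x k1 * xi i \in I by apply: minor_in; rewrite /= ltnS def_a.
- exists (x k1 * y j0 + x i * theta k1).
    by apply: reducedD; [exact: reduced_xy | exact: reduced_xtheta].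
  have i0 : i = ord0 by apply: val_inj.
  rewrite rmorphD !rmorphM !sub_x sub_y eqxx xk.
  have -> : x i * (xi k1 + sub (theta k1)) - (x k1 * y j0 + x i * sub (theta k1)) =
    x i * xi k1 - x k1 * y j0 by ring.
  by rewrite -xi0 -i0.
- have i_gt0 : (0 < i)%N by rewrite def_a.
  have pred_i : nat_of_ord (ord_pred i) = a.
    by rewrite /= def_a /= modnDr modn_small // -def_a ltnW.
  have [|s s_red s_eq] := IHa (ord_pred i) k1 pred_i.
    by rewrite /= ltnW // ltnW.
  (* The minor of columns i and k + 1 is expanded with xi_(k+1) = x_k - theta_(k+1) and xi_i =
     x_(i-1) - theta_i; s reduces x_(i-1) x_(k+1). *)
  exists (s - x k1 * theta i + x i * theta k1).
    apply: reducedD; last exact: reduced_xtheta.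
    by apply: reducedB => //; exact: reduced_xtheta.
  rewrite rmorphD rmorphB !rmorphM !sub_x xk (sub_theta i_gt0).
  have -> : x i * (xi k1 + sub (theta k1)) -
      (sub s - x k1 * (x (ord_pred i) - xi i) + x i * sub (theta k1)) =
    (x i * xi k1 - x k1 * xi i) + (x (ord_pred i) * x k1 - sub s) by ring.
  exact: (linD I_lin).
Qed.

Lemma J_quad a b : isz a -> isz b -> exists s : S,
  [/\ s \is 2.-homog, {in msupp s, forall m, zdeg isz m <= 1}%N
    & 'X_a * 'X_b - s \in J].
Proof.
elim/idxP: a => [i|j]; last by rewrite isz_y.
elim/idxP: b => [k|j] _; last by rewrite isz_y.
rewrite -/(x i) -/(x k) => _; have [le_ik|/ltnW le_ki] := leqP i k.
  have [s [s_homog s_supp] s_eq] := quad_reduce le_ik.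
  by exists s; split=> //; rewrite mem_J rmorphB rmorphM !sub_x.
have [s [s_homog s_supp] s_eq] := quad_reduce le_ki.
by exists s; split=> //; rewrite mem_J rmorphB rmorphM !sub_x mulrC.
Qed.

Definition theta_nat k : S := if insub k is Some i then theta i else 0.

Fixpoint u k : {poly S} :=
  if k is k'.+1 then u k' * 'X - (theta_nat k)%:P else (y j0)%:P.

(** The original coordinates are used here, y_j being [xi] at j; after [sub], every y_j goes to a
    constant in t ([sub_phi_var]). *)
Definition phi_var (v : 'I_V) : {poly S} :=
  match enum_val v with inl i => u i * 'X | inr j => u (val j) end.

Definition phi : {rmorphism S -> {poly S}} :=
  mmap (polyC \o @mpolyC V K) phi_var.

Lemma phiC c : phi c%:MP = c%:MP%:P.
Proof. exact: mmapC. Qed.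

Lemma phi_x i : phi (x i) = u i * 'X.
Proof. by rewrite /phi /= mmapX mmap1U /phi_var enum_rankK. Qed.

Lemma phi_y j : phi (y j) = u (val j).
Proof. by rewrite /phi /= mmapX mmap1U /phi_var enum_rankK. Qed.

Lemma u_pred (i : 'I_n) : (0 < i)%N -> u i = u (ord_pred i) * 'X - (theta i)%:P.
Proof.
move=> i_gt0; have def_i : nat_of_ord i = (ord_pred i).+1.
  have lt_in := ltn_ord i; rewrite /= -(prednK i_gt0) addSn /= modnDr modn_small //.
  by rewrite prednK // ltnW.
by rewrite {1}def_i /= -[(_ %% _).+1]def_i /theta_nat valK.
Qed.

Lemma phi_xi i : phi (xi i) = u i.
Proof.
rewrite /Defs.xi; case: insubP => [j _ def_j|/negPn i_delta].
  by rewrite phi_y def_j.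
rewrite phi_x (@u_pred i) ?delta_gt0 // /theta insubN ?i_delta //.
by rewrite subr0.
Qed.

Lemma phi_I p : p \in I -> phi p = 0.
Proof.
case/asboolP=> c ->; rewrite rmorph_sum big1 // => k _; rewrite rmorphM.
have /imageP[[i j] _ ->] := mem_nth 0 (ltn_ord k).
by rewrite /minor2 !mxE /= rmorphB !rmorphM !phi_x !phi_xi; ring.
Qed.

Lemma size_u k : size (u k) = k.+1 /\ lead_coef (u k) = y j0.
Proof.
elim: k => [|k [size_k lead_k]] /=.
  rewrite lead_coefC size_polyC; split=> //.
  by rewrite -msize_poly_eq0 msizeX.
have u_neq0 : u k != 0 by rewrite -size_poly_eq0 size_k.
have lt_size : (size (- (theta_nat k.+1)%:P)%R < size (u k * 'X)%R)%N.
  rewrite size_polyN size_mulX // size_k size_polyC.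
  by case: (_ != 0).
rewrite size_polyDl // lead_coefDl // lead_coefMX lead_k.
by rewrite size_mulX // size_k.
Qed.

(** [tdeg] and [ylead] are the degree in t and the exponent of the leading coefficient of phi (sub
    X^m), both additive in m ([sub_phi_lead]). *)
Definition tdeg1 (v : 'I_V) : nat := if enum_val v is inl i then i.+1 else 0%N.
Definition ylead1 (v : 'I_V) : mnm :=
  if enum_val v is inl _ then U_(yidx j0)%MM else U_(v)%MM.
Definition tdeg (m : mnm) : nat := (\sum_v m v * tdeg1 v)%N.
Definition ylead (m : mnm) : mnm := [multinom (\sum_v m v * ylead1 v w)%N | w < V].

Lemma sub_phi_var v :
  size (phi (sub 'X_v)) = (tdeg1 v).+1 /\ lead_coef (phi (sub 'X_v)) = 'X_[ylead1 v].
Proof.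
elim/idxP: v => [i|j]; rewrite /tdeg1 /ylead1 enum_rankK.
  have [size_i lead_i] := size_u i.
  have u_neq0 : u i != 0 by rewrite -size_poly_eq0 size_i.
  rewrite -[mpolyX _ _]/(x i) sub_x phi_x size_mulX // size_i lead_coefMX lead_i.
  by [].
rewrite -[mpolyX _ _]/(y j) sub_y.
suff -> : phi (if val j == 0 then y j else x (ord_pred (val j)) - y j) = (y j)%:P.
  rewrite lead_coefC size_polyC -msize_poly_eq0 msizeX; split=> //.
case: eqP => [j_eq0|/eqP j_neq0].
  by rewrite phi_y j_eq0 /= (_ : j = j0) //; apply: val_inj.
have j_gt0 : (0 < val j)%N by rewrite lt0n; apply: contra j_neq0 => /eqP H; apply/eqP/val_inj.
rewrite rmorphB phi_x phi_y (u_pred j_gt0) opprB addrC subrK.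
by rewrite /theta insubT ?(valP j) // => H; congr (yvar _ _)%:P; apply: val_inj.
Qed.

Lemma tdegD m1 m2 : tdeg (m1 + m2)%MM = (tdeg m1 + tdeg m2)%N.
Proof. by rewrite -big_split; apply: eq_bigr => v _; rewrite mnmDE mulnDl. Qed.

Lemma yleadD m1 m2 : ylead (m1 + m2)%MM = (ylead m1 + ylead m2)%MM.
Proof.
apply/mnmP=> w; rewrite mnmDE !mnmE -big_split; apply: eq_bigr => v _.
by rewrite mnmDE mulnDl.
Qed.

Lemma sum_var (f : 'I_V -> nat) v : (\sum_w U_(v)%MM w * f w)%N = f v.
Proof.
rewrite (bigD1 v) //= mnm1E eqxx mul1n big1 ?addn0 // => w neq_wv.
by rewrite mnm1E eq_sym (negPf neq_wv).
Qed.

Lemma mnm_ind (P : mnm -> Prop) : P 0%MM -> (forall v, P U_(v)%MM) ->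
  (forall m1 m2, P m1 -> P m2 -> P (m1 + m2)%MM) -> forall m, P m.
Proof.
move=> P0 P1 PD m; rewrite [m]multinomUE_id; apply: big_ind => // v _.
elim: (m v) => [|k IHk]; first by rewrite mulm0n.
by rewrite mulmS; apply: PD.
Qed.

Lemma size_lead_mul (p q : {poly S}) a b (m1 m2 : mnm) :
    size p = a.+1 /\ lead_coef p = 'X_[m1] -> size q = b.+1 /\ lead_coef q = 'X_[m2] ->
  size (p * q) = (a + b).+1 /\ lead_coef (p * q) = 'X_[m1 + m2].
Proof.
move=> [size_p lead_p] [size_q lead_q].
have p_neq0 : p != 0 by rewrite -size_poly_eq0 size_p.
have q_neq0 : q != 0 by rewrite -size_poly_eq0 size_q.
by rewrite size_mul // lead_coefM lead_p lead_q mpolyXD size_p size_q addSn addnS.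
Qed.

Lemma sub_phi_lead m : size (phi (sub 'X_[m])) = (tdeg m).+1 /\
  lead_coef (phi (sub 'X_[m])) = 'X_[ylead m].
Proof.
elim/mnm_ind: m => [|v|m1 m2 IH1 IH2].
- rewrite mpolyX0 !rmorph1 size_poly1 lead_coef1; split.
    by rewrite /tdeg big1 // => v _; rewrite mnm0E.
  rewrite -mpolyX0; congr mpolyX; apply/mnmP=> w.
  by rewrite mnm0E mnmE big1 // => v _; rewrite mnm0E mul0n.
- have [size_v lead_v] := sub_phi_var v; rewrite size_v lead_v /tdeg sum_var.
  by split=> //; congr mpolyX; apply/mnmP=> w; rewrite mnmE sum_var.
- have -> : phi (sub 'X_[m1 + m2]) = phi (sub 'X_[m1]) * phi (sub 'X_[m2]).
    by rewrite mpolyXD (rmorphM sub) (rmorphM phi).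
  by rewrite tdegD yleadD; apply: size_lead_mul.
Qed.

Definition zpart (m : mnm) : nat := (\sum_(v | isz v) m v * tdeg1 v)%N.

Lemma tdeg_split m : tdeg m = (m (xidx ord_max) * n + zpart m)%N.
Proof.
have last_nz : ~~ isz (xidx ord_max) by rewrite isz_x ltnn.
have tdeg_last : tdeg1 (xidx ord_max) = n by rewrite /tdeg1 enum_rankK.
rewrite /tdeg (bigID isz) /= addnC; congr (_ + _)%N.
rewrite (bigD1 (xidx ord_max)) //= tdeg_last big1 ?addn0 // => v.
elim/idxP: v => [i|j]; last by rewrite /tdeg1 enum_rankK muln0.
rewrite isz_x => /andP[i_last /eqP neq_i]; case: neq_i; congr xidx.
by apply: val_inj => /=; have := ltn_ord i; lia.
Qed.

Lemma isz_tdeg v : isz v -> (0 < tdeg1 v < n)%N.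
Proof.
by elim/idxP: v => [i|j]; rewrite ?isz_y // isz_x /tdeg1 enum_rankK.
Qed.

Lemma tdeg1_inj v w : isz v -> isz w -> tdeg1 v = tdeg1 w -> v = w.
Proof.
elim/idxP: v => [i|j]; last by rewrite isz_y.
elim/idxP: w => [k|j]; last by rewrite isz_y.
by move=> _ _; rewrite /tdeg1 !enum_rankK => -[/val_inj ->].
Qed.

Lemma zpart_std m : (zdeg isz m <= 1)%N ->
  (zpart m < n)%N /\ forall v, isz v -> m v = (tdeg1 v == zpart m) :> nat.
Proof.
move=> m_std; have [v0 /andP[zv0 mv0]|no_v] := pickP (fun v => isz v && (m v != 0%N)).
  have m1 : m v0 = 1%N.
    by move: m_std mv0; rewrite /zdeg (bigD1 v0) //=; case: (m v0) => [|[|k]].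
  have m0 w : isz w -> w != v0 -> m w = 0%N.
    move=> zw neq_w; move: m_std.
    by rewrite /zdeg (bigD1 v0) //= (bigD1 w) /= ?zw // m1; lia.
  have zpartE : zpart m = tdeg1 v0.
    rewrite /zpart (bigD1 v0) //= m1 mul1n big1 ?addn0 // => w /andP[zw neq_w].
    by rewrite m0.
  rewrite zpartE; split=> [|w zw]; first by case/andP: (isz_tdeg zv0).
  case: eqP => [/(tdeg1_inj zw zv0) -> //|neq_t]; apply: m0 => //.
  by apply/eqP=> eq_w; case: neq_t; rewrite eq_w.
have m0 w : isz w -> m w = 0%N.
  by move=> zw; have := no_v w; rewrite zw /= => /negPn/eqP.
have -> : zpart m = 0%N by rewrite /zpart big1 // => w zw; rewrite m0.
by split=> // w zw; rewrite m0 //; case/andP: (isz_tdeg zw); case: (tdeg1 w).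
Qed.

(** The z-variables have the distinct t-degrees 1, ..., n-1, x_n has t-degree n and the y_j have 0.
    So division of [tdeg] by n returns the exponent of x_n as quotient and the z-variable as
    remainder; then [ylead], to which each x contributes a factor y_1, returns the exponents of the
    y_j. *)
Lemma std_monomial_inj m1 m2 :
    (zdeg isz m1 <= 1)%N -> (zdeg isz m2 <= 1)%N ->
  tdeg m1 = tdeg m2 -> ylead m1 = ylead m2 -> m1 = m2.
Proof.
move=> std1 std2; have [lt1 mz1] := zpart_std std1; have [lt2 mz2] := zpart_std std2.
rewrite !tdeg_split => eq_t /mnmP eq_y.
have eq_z : zpart m1 = zpart m2.
  by have := congr1 (modn^~ n) eq_t; rewrite !modnMDl !modn_small.
have eq_last : m1 (xidx ord_max) = m2 (xidx ord_max).
  by have := congr1 (divn^~ n) eq_t; rewrite !divnMDl // !divn_small // !addn0.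
have eq_x i : m1 (xidx i) = m2 (xidx i).
  have [zi|] := boolP (isz (xidx i)); first by rewrite mz1 // mz2 // eq_z.
  rewrite isz_x => i_last; rewrite (_ : i = ord_max) //.
  by apply: val_inj => /=; have := ltn_ord i; lia.
apply/mnmP; elim/idxP=> // j.
pose isx (v : 'I_V) := if enum_val v is inl _ then true else false.
have sum_y (m : mnm) : ylead m (yidx j) =
    (\sum_(v | isx v) m v * ylead1 v (yidx j) + m (yidx j))%N.
  rewrite mnmE (bigID isx) /=; congr (_ + _)%N.
  rewrite (bigD1 (yidx j)) /=; last by rewrite /isx enum_rankK.
  rewrite big1 => [|v]; first by rewrite /ylead1 enum_rankK mnm1E eqxx muln1 addn0.
  elim/idxP: v => [i|k]; first by rewrite /isx enum_rankK.
  by rewrite /ylead1 enum_rankK mnm1E => /andP[_ /negPf ->]; rewrite muln0.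
have := eq_y (yidx j); rewrite !sum_y.
rewrite (eq_bigr (fun v => m2 v * ylead1 v (yidx j))%N) => [/addnI //|v].
by elim/idxP: v => [i|k]; rewrite /isx enum_rankK // => _; rewrite eq_x.
Qed.

(** Among the monomials of p of largest t-degree, no two share a leading coefficient by
    [std_monomial_inj], so their top terms in t cannot cancel. *)
Lemma sub_phi_std0 p : {in msupp p, forall m, zdeg isz m <= 1}%N ->
  phi (sub p) = 0 -> p = 0.
Proof.
move=> p_std phi0; apply: contrapT => /eqP p_neq0.
have exP : exists t, has (fun m => tdeg m == t) (msupp p).
  by exists (tdeg (mlead p)); apply/hasP; exists (mlead p); rewrite ?mlead_supp.
have leP t : has (fun m => tdeg m == t) (msupp p) -> (t <= \max_(m <- msupp p) tdeg m)%N.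
  by case/hasP=> m pm /eqP <-; rewrite (big_rem m) //= leq_maxl.
case: (ex_maxnP exP leP) => t /hasP[m0 pm0 /eqP def_t] t_max.
have lead_m m : m \in msupp p ->
    ((phi (sub 'X_[m]))`_t)@_(ylead m0) = (m == m0)%:R.
  move=> pm; have [size_m lead_m] := sub_phi_lead m.
  have le_mt : (tdeg m <= t)%N by apply: t_max; apply/hasP; exists m.
  have [eq_mt|neq_mt] := eqVneq (tdeg m) t.
    have -> : (phi (sub 'X_[m]))`_t = 'X_[ylead m].
      by rewrite -lead_m lead_coefE size_m eq_mt.
    rewrite mcoeffX; congr (nat_of_bool _)%:R; apply/eqP/eqP=> [eq_y|-> //].
    by apply: std_monomial_inj => //; rewrite ?p_std // eq_mt def_t.
  rewrite nth_default ?mcoeff0; last by rewrite size_m ltn_neqAle neq_mt.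
  by case: (m =P m0) neq_mt => // ->; rewrite def_t eqxx.
have : ((phi (sub p))`_t)@_(ylead m0) = p@_m0.
  rewrite {1}[p]mpolyE (rmorph_sum sub) (rmorph_sum phi) coef_sum raddf_sum /=.
  rewrite (bigD1_seq m0) ?msupp_uniq //= big_seq_cond big1 => [|m /andP[pm neq_m]].
    rewrite addr0 -mul_mpolyC (rmorphM sub) (rmorphM phi) linear_substC phiC coefCM mcoeffCM.
    by rewrite lead_m // eqxx mulr1.
  rewrite -mul_mpolyC (rmorphM sub) (rmorphM phi) linear_substC phiC coefCM mcoeffCM.
  by rewrite lead_m // (negPf neq_m) mulr0.
rewrite phi0 coef0 mcoeff0 => /esym/eqP.
by apply/negP; rewrite -mcoeff_msupp.
Qed.

Lemma J_std0 p : p \in J -> {in msupp p, forall m, zdeg isz m <= 1}%N -> p = 0.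
Proof. by rewrite mem_J => /phi_I phi0 p_std; apply: sub_phi_std0. Qed.

(** The standard remainder of sub p modulo J is killed by phi after [sub], hence it is 0. *)
Lemma mem_I_phi p : (p \in I) = (phi p == 0).
Proof.
apply/idP/eqP=> [/phi_I //|phi0].
have [s s_std Js] := normal_formE J_lin J_quad J_std0 (sub p).
have /phi_I : sub (sub p - s) \in I := Js.
rewrite rmorphB sub_inv rmorphB phi0 sub0r => /eqP; rewrite oppr_eq0 => /eqP s0.
by move: Js; rewrite (sub_phi_std0 s_std s0) subr0 mem_J sub_inv.
Qed.

Theorem minor_ideal_prime : prime_ideal I.
Proof.
split; first exact: minor_ideal_closed.
by move=> p q; rewrite !mem_I_phi rmorphM mulf_eq0.
Qed.

Theorem minor_ideal_linear_resolution : linear_resolution 2 I.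
Proof.
apply: (linear_resolution_subst sub_var_homog sub_inv (I := J)) => [p|].
  by rewrite mem_J sub_inv.
exact: linear_resolution_of_quadratic_complement J_lin J_quad J_std0.
Qed.

Theorem minor_quotient_cm : cohen_macaulay {ideal_quot I}.
Proof.
(* Precomposing the quotient map with [sub] gives it the kernel J. *)
pose rho : {rmorphism S -> {ideal_quot I}} := \pi_{ideal_quot I}%qT \o sub.
apply: (quadratic_complement_cm J_lin J_quad J_std0 (rho := rho)) => [z|p].
  by exists (sub (repr z)); rewrite /rho /= sub_inv reprK.
by rewrite mem_J -[sub p]subr0 Quotient.idealrBE rmorph0.
Qed.

End Scroll.

Theorem theorem1p1 (K : fieldType) (n : nat) (delta : {set 'I_n}) :
  (1 <= n)%N ->
  (forall i : 'I_n, i \in delta -> (0 < i)%N) ->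
  [/\ prime_ideal (minor_ideal K delta),
      cohen_macaulay {ideal_quot (minor_ideal K delta)}
    & linear_resolution 2 (minor_ideal K delta)].
Proof.
case: n delta => // n delta _ delta_gt0; split.
- exact: minor_ideal_prime.
- exact: minor_quotient_cm.
- exact: minor_ideal_linear_resolution.
Qed.
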